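(* Let $d\ge 2$ and $p,q,r\in[1,\infty]$. (i) If $\frac1p\le\frac1q+\frac1r$ and it is not the case that ($p>2$, $q<2$ and $r<2$), then $$C_{p,q,r}=\max\left\{2^{1/p},\,2^{1-1/q},\,2^{1-1/r},\,2^{1+1/p-1/q-1/r}\right\}.$$ The four segments of this parameter region corresponding to each of the four arguments of the maximum are given as follows: - $C_{p,q,r}=2^{1/p}$ when $q\le p'$, $r\le p'$, $r\le q'$ and $p\le 2$; - $C_{p,q,r}=2^{1-1/r}$ when $r\ge p'$, $q\le r$, $q\le p$ and $r\ge 2$; - $C_{p,q,r}=2^{1-1/q}$ when $q\ge p'$, $r\le q$, $r\le p$ and $q\ge 2$; - $C_{p,q,r}=2^{1+1/p-1/q-1/r}$ when $\frac1p\le\frac1q+\frac1r$, $q\ge p$, $r\ge p$ and $r\ge q'$. (ii) If $\frac1p\ge\frac1q+\frac1r$ and $d$ is even, then $$C_{p,q,r}=2\,d^{\,1/p-1/q-1/r}.$$ If $\frac1p\ge\frac1q+\frac1r$ and $d$ is odd, then $C_{p,q,r}\le 2\,d^{\,1/p-1/q-1/r}$.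
   Context: For a complex $d\times d$ matrix $X$ with singular values $\sigma_1\ge\dots\ge\sigma_d\ge 0$, the Schatten $p$-norm is $\|X\|_p=(\sigma_1^p+\cdots+\sigma_d^p)^{1/p}$ for $1\le p<\infty$, and $\|X\|_\infty=\sigma_1$. Convention: $1/\infty=0$. For $p\in[1,\infty]$, $p'\in[1,\infty]$ denotes the conjugate index, $\frac1p+\frac1{p'}=1$. For $p,q,r\in[1,\infty]$, $C_{p,q,r}$ denotes the smallest constant $C$ such that $\|XY-YX\|_p\le C\,\|X\|_q\,\|Y\|_r$ for all complex $d\times d$ matrices $X,Y$. *)

(* Defs.v *)
From HB Require Import structures.
From mathcomp Require Import all_boot all_order all_algebra.
From mathcomp Require Import complex.
From mathcomp Require Import all_classical all_reals all_analysis.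

Set Implicit Arguments.
Unset Strict Implicit.
Unset Printing Implicit Defensive.

Import Order.TTheory GRing.Theory Num.Theory.
Local Open Scope complex_scope.
Local Open Scope sesquilinear_scope.
Local Open Scope classical_set_scope.
Local Open Scope ring_scope.

(* The singular values of X are the square roots of the eigenvalues, with
   multiplicity, of the Hermitian matrix X^* X. These eigenvalues are elements
   of R[i] that are real and nonnegative, so taking the real part loses
   nothing. *)
Definition singular_values (R : realType) (d : nat) (X : 'M[R[i]]_d) : seq R :=
  sort >=%R [seq Num.sqrt (complex.Re (spectral_diag (X^t* *m X) 0 i))
                | i <- enum 'I_d].

(* For p = +oo this is the largest singular value: singular_values is sorted in
   decreasing order. Only 1 <= p is meaningful. *)
Definition schatten_norm (R : realType) (d : nat) (p : \bar R)
    (X : 'M[R[i]]_d) : R :=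
  match p with
  | p'%:E => (\sum_(s <- singular_values X) s `^ p') `^ p'^-1
  | +oo%E => head 0 (singular_values X)
  | -oo%E => 0
  end.

Definition commutator_bounds (R : realType) (d : nat) (p q r : \bar R) : set R :=
  [set C | forall X Y : 'M[R[i]]_d,
     schatten_norm p (X *m Y - Y *m X) <=
       C * schatten_norm q X * schatten_norm r Y].

Definition is_commutator_constant (R : realType) (d : nat) (p q r : \bar R)
    (C : R) : Prop :=
  commutator_bounds d p q r C /\ lbound (commutator_bounds d p q r) C.

(* 1/p as a real number, with 1/+oo = 0. *)
Definition rinv (R : realType) (p : \bar R) : R := fine (p^-1)%E.

(* Main.v *)
Require Import Defs.
From HB Require Import structures.
From mathcomp Require Import all_boot all_order all_algebra.
From mathcomp Require Import complex.
From mathcomp Require Import ring lra.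
From mathcomp Require Import all_classical all_reals all_analysis.

Set Implicit Arguments.
Unset Strict Implicit.
Unset Printing Implicit Defensive.

Import Order.TTheory GRing.Theory Num.Theory.
Import numFieldNormedType.Exports.
Local Open Scope sesquilinear_scope.
Local Open Scope ring_scope.

(* By duality the bound on [X, Y] is a bound on the trilinear form
   tr (Z [X, Y]) in terms of the Schatten norms of Z, X, Y with exponents
   1 - 1/p, 1/q, 1/r. Writing each matrix as U diag(e_i exp(a lam_i)) V with
   contractions U, V makes the form a finite sum of exponentials along any line
   of exponents, so the three lines theorem shows that the best constant is
   log-convex in the exponent triple; it is also nonincreasing in each
   coordinate. The known values are 2d at (0,0,0), 2 at the three unit vectors,
   and sqrt 2 at (1/2,1/2,1/2) (the Boettcher-Wenzel inequality, proved by
   Audenaert's variance argument). Interpolating and using monotonicity gives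
   all upper bounds; matrices with at most one nonzero entry in each row and
   column give the matching lower bounds. *)

(** * Complex modulus and the three lines theorem *)

(** The form tr (Z [X, Y]) is alternating, so its bounds are symmetric in the exponents (a, b, c) =
    (1 - 1/p, 1/q, 1/r). In these coordinates the four arguments of the maximum are 2^(1-a),
    2^(1-b), 2^(1-c) and 2^(2-s) with s = a + b + c; case (i) is s >= 1 and case (ii) is s <= 1.
    Interpolation yields 2^(2-s) on the tetrahedron spanned by the unit vectors and (1/2, 1/2, 1/2).
    Any other point of (i) is brought into it by lowering its two larger coordinates until they sum
    to 1; the bound is then 2^(1-z) with z the smallest coordinate. This needs z <= 1/2, whence the
    excluded case p > 2, q < 2, r < 2, in which all three coordinates exceed 1/2. The factor e_i is
    kept apart from exp(a lam_i) because a zero singular value has no logarithm and because phases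
    must be absorbed when the exponent becomes complex. *)

Section ComplexModulus.
Variable R : realType.
Implicit Types (z w : R[i]) (a b t x y h : R).

Definition cabs z : R := Normc.normc z.

Lemma cabsE z : `|z| = (cabs z)%:C%C.
Proof. by []. Qed.

Lemma cabsM z w : cabs (z * w) = cabs z * cabs w.
Proof. exact: Normc.normcM. Qed.

Lemma cabs0 : cabs 0 = 0.
Proof. exact: Normc.normc0. Qed.

Lemma cabs1 : cabs 1 = 1.
Proof. exact: Normc.normc1. Qed.

Lemma cabs_ge0 z : 0 <= cabs z.
Proof. by case: z => a b; exact: sqrtr_ge0. Qed.

Lemma cabs_sum (I : finType) (F : I -> R[i]) :
  cabs (\sum_i F i) <= \sum_i cabs (F i).
Proof.
elim/big_ind2: _ => [|z a w b za wb|//]; first by rewrite /cabs Normc.normc0.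
by rewrite (le_trans (le_normcD a b)) ?lerD.
Qed.

Lemma cabs_real a : cabs a%:C%C = `|a|.
Proof. by rewrite /cabs /= expr0n addr0 sqrtr_sqr. Qed.

Lemma cabs_subl z w : cabs z <= cabs w + cabs (z - w).
Proof. by rewrite -{1}(subrKC w z); exact: le_normcD. Qed.

Definition cis y : R[i] := (cos y +i* sin y)%C.

Lemma cabs_cis y : cabs (cis y) = 1.
Proof. by rewrite /cabs /= cos2Dsin2 sqrtr1. Qed.

Lemma cis0 : cis 0 = 1.
Proof. by rewrite /cis cos0 sin0. Qed.

Lemma cisD x y : cis (x + y) = cis x * cis y.
Proof.
apply/eqP; rewrite eq_complex /= cosD sinD.
by apply/andP; split; apply/eqP; ring.
Qed.

Lemma cis_second_difference y h :
  cis (y + h) + cis (y - h) = (2 * cos h)%:C%C * cis y.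
Proof.
apply/eqP; rewrite !cisD eq_complex /= cosN sinN.
by apply/andP; split; apply/eqP; ring.
Qed.

End ComplexModulus.

Arguments cabs : simpl never.

(** * Taylor estimate for cosh t + cos t *)

Section CoshPlusCos.
Variable R : realType.
Implicit Types (t a b : R).

(** The mean value theorem gives f t = t f'(c) with 0 <= c <= t, and the bound on f' increases with
    its argument. Iteration yields a Taylor bound without factorials. *)
Lemma MVT_pow (f df : R -> R) (C : R) (n : nat) : f 0 = 0 -> 0 <= C ->
  (forall t, is_derive t 1 f (df t)) ->
  (forall t, 0 <= t -> `|df t| <= C * t ^+ n * expR t) ->
  forall t, 0 <= t -> `|f t| <= C * t ^+ n.+1 * expR t.
Proof.
move=> f0 C0 fdf dfC t t0.
have fcont : {within `[0, t], continuous f}%classic.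
  apply: continuous_subspaceT => x; apply: differentiable_continuous.
  by apply/derivable1_diffP; case: (fdf x).
have [c /itvP ct] := MVT_segment t0 (fun x _ => fdf x) fcont.
rewrite f0 !subr0 => ->.
rewrite normrM (ger0_norm t0) exprSr mulrA mulrAC ler_wpM2r//.
rewrite (le_trans (dfC c _)) ?ct//.
apply: ler_pM; rewrite ?expR_ge0 ?mulr_ge0 ?exprn_ge0 ?ct//.
  by rewrite ler_wpM2l// lerXn2r ?nnegrE ?ct.
by rewrite ler_expR ct.
Qed.

(** The expression in the modulus vanishes at 0 with its first two derivatives, and its third
    derivative is at most 4 e^t for t >= 0. Cubic order suffices, since the maximum principle below
    tolerates any error o(h^2). *)
Lemma coshDcos_bound t :
  `|expR t + expR (- t) + 2 * cos t - 4| <= 4 * `|t| ^+ 3 * expR `|t|.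
Proof.
wlog t0 : t / 0 <= t => [H|].
  have [/H//|/ltW t0] := leP 0 t.
  by have := H (- t); rewrite oppr_ge0 cosN normrN opprK [expR (- t) + _]addrC; exact.
rewrite (ger0_norm t0).
pose f2 t : R := expR t + expR (- t) - 2 * cos t.
pose f1 t : R := expR t - expR (- t) - 2 * sin t.
pose f0 t : R := expR t + expR (- t) + 2 * cos t - 4.
apply: (@MVT_pow f0 f1 4 2) => //; rewrite /f0 /f1.
- by rewrite oppr0 expR0 cos0; lra.
- by move=> x; apply: is_derive_eq; rewrite /GRing.scale/=; lra.
apply: (@MVT_pow f1 f2 4 1) => //; rewrite /f2 /f1.
- by rewrite oppr0 expR0 sin0; lra.
- by move=> x; apply: is_derive_eq; rewrite /GRing.scale/=; lra.
apply: (@MVT_pow f2 (fun t => expR t - expR (- t) + 2 * sin t) 4 0) => //; rewrite /f2.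
- by rewrite oppr0 expR0 cos0; lra.
- by move=> x; apply: is_derive_eq; rewrite /GRing.scale/=; lra.
move=> x x0; rewrite expr0 mulr1.
have h1 : 1 <= expR x by rewrite -expR0 ler_expR.
have h2 : expR (- x) <= 1 by rewrite -expR0 ler_expR oppr_le0.
have h3 := expR_gt0 (- x).
have := sin_le1 x; have := sin_geN1 x => s1 s2.
by rewrite ler_norml; apply/andP; split; lra.
Qed.

End CoshPlusCos.

(** * Three lines theorem for finite exponential sums *)

Section ThreeLines.
Variables (R : realType) (I : finType).
Implicit Types (g : I -> R[i]) (mu : I -> R) (x y h : R).

(** The entire function sum_i g_i exp(mu_i z) at z = x + iy. *)
Definition expsum g mu x y : R[i] :=
  \sum_i g i * (expR (mu i * x))%:C%C * cis (mu i * y).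

Lemma expR_le_norm mu (i : I) x : 0 <= x <= 1 ->
  expR (mu i * x) <= expR `|mu i|.
Proof.
move=> /andP[x0 x1]; rewrite ler_expR (le_trans (ler_norm _))//.
by rewrite normrM (ger0_norm x0) ler_piMr.
Qed.

Lemma expsum_bounded g mu : exists K, forall x y, 0 <= x <= 1 ->
  cabs (expsum g mu x y) <= K.
Proof.
exists (\sum_i cabs (g i) * expR `|mu i|) => x y x01.
apply: (le_trans (cabs_sum _)); apply: ler_sum => i _.
rewrite !cabsM cabs_cis mulr1 cabs_real ger0_norm ?expR_ge0//.
by rewrite ler_wpM2l ?cabs_ge0 ?expR_le_norm.
Qed.

Lemma expR_lipschitz mu (i : I) x x' : 0 <= x <= 1 -> 0 <= x' <= 1 ->
  `|expR (mu i * x) - expR (mu i * x')| <= `|mu i| * expR `|mu i| * `|x - x'|.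
Proof.
have main a b : 0 <= a <= 1 ->
  expR (mu i * a) - expR (mu i * b) <= `|mu i| * expR `|mu i| * `|a - b|.
  move=> a01.
  have -> : expR (mu i * b) = expR (mu i * a) * expR (mu i * (b - a)).
    by rewrite -expRD; congr expR; ring.
  rewrite -[X in X - _]mulr1 -mulrBr mulrAC [leRHS]mulrC.
  apply: (@le_trans _ _ (expR (mu i * a) * (`|mu i| * `|a - b|))).
    rewrite ler_wpM2l ?expR_ge0// -normrM.
    have := expR_ge1Dx (mu i * (b - a)); have := ler_norm (mu i * (a - b)).
    lra.
  by rewrite ler_wpM2r ?expR_le_norm// mulr_ge0.
move=> x01 x'01; rewrite ler_norml main// lerNl opprB.
by rewrite distrC main.
Qed.

Lemma expsum_lipschitz g mu : exists L, 0 <= L /\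
  forall x x' y, 0 <= x <= 1 -> 0 <= x' <= 1 ->
  cabs (expsum g mu x y) <= cabs (expsum g mu x' y) + L * `|x - x'|.
Proof.
exists (\sum_i cabs (g i) * (`|mu i| * expR `|mu i|)); split.
  by apply: sumr_ge0 => i _; rewrite !mulr_ge0 ?cabs_ge0 ?expR_ge0.
move=> x x' y x01 x'01; apply: (le_trans (cabs_subl _ (expsum g mu x' y))).
rewrite lerD2l /expsum -sumrB; apply: (le_trans (cabs_sum _)).
rewrite mulr_suml; apply: ler_sum => i _.
rewrite -mulrBl -mulrBr -rmorphB /= !cabsM cabs_cis mulr1 cabs_real -mulrA.
by rewrite ler_wpM2l ?cabs_ge0 ?expR_lipschitz.
Qed.

(* As cosh t + cos t = 2 + O(t^4), an exponential is nearly equal to its average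
   over the four neighbours of a point at distance h. *)
Lemma expsum_average g mu : exists K, 0 <= K /\
  forall x y h, 0 <= x <= 1 -> 0 <= h <= 1 ->
  4 * cabs (expsum g mu x y) <=
    cabs (expsum g mu (x + h) y) + cabs (expsum g mu (x - h) y)
    + cabs (expsum g mu x (y + h)) + cabs (expsum g mu x (y - h)) + K * h ^+ 3.
Proof.
exists (\sum_i cabs (g i) * expR `|mu i| * (4 * `|mu i| ^+ 3 * expR `|mu i|)).
split.
  apply: sumr_ge0 => i _.
  by rewrite !mulr_ge0 ?cabs_ge0 ?expR_ge0 ?exprn_ge0.
move=> x y h x01 /andP[h0 h1].
set K := \sum_i _.
set a := expsum g mu (x + h) y; set b := expsum g mu (x - h) y.
set c := expsum g mu x (y + h); set e := expsum g mu x (y - h).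
have tri : cabs (a + b + c + e) <= cabs a + cabs b + cabs c + cabs e.
  by do 2?[rewrite (le_trans (le_normcD _ _))// lerD2r];
     rewrite (le_trans (le_normcD _ _)).
have -> : 4 * cabs (expsum g mu x y) = cabs (4 * expsum g mu x y).
  by rewrite cabsM -[4 : R[i]](rmorph_nat (real_complex R)) cabs_real normr_nat.
apply: (le_trans (cabs_subl _ (a + b + c + e))); apply: lerD => //.
(* Passing to the four neighbours multiplies the i-th term by exp(mu_i h), exp(- mu_i h), cis(mu_i
   h) and cis(- mu_i h), which add up to 2 cosh(mu_i h) + 2 cos(mu_i h). *)
have -> : 4 * expsum g mu x y - (a + b + c + e) =
  \sum_i g i * (expR (mu i * x))%:C%C * cis (mu i * y) *
  (4 - (expR (mu i * h) + expR (- (mu i * h)) + 2 * cos (mu i * h)))%:C%C.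
  rewrite /a /b /c /e /expsum mulr_sumr -!big_split/= -sumrB.
  apply: eq_bigr => i _.
  rewrite (mulrDr _ x h) (mulrBr _ x h) (mulrDr _ y h) (mulrBr _ y h).
  have := cis_second_difference (mu i * y) (mu i * h).
  rewrite !expRD => E.
  rewrite [in RHS]rmorphB [in RHS]rmorphD/= -addrA -mulrDr E.
  rewrite -[4 : R[i]](rmorph_nat (real_complex R)).
  by rewrite !(rmorphM, rmorphD)/= rmorph1; ring.
apply: (le_trans (cabs_sum _)); rewrite /K mulr_suml; apply: ler_sum => i _.
rewrite !cabsM cabs_cis mulr1 !cabs_real (ger0_norm (expR_ge0 _)) distrC.
rewrite -[leRHS]mulrA.
apply: ler_pM; rewrite ?mulr_ge0 ?cabs_ge0 ?expR_ge0//.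
  by rewrite ler_wpM2l ?cabs_ge0 ?expR_le_norm.
apply: (le_trans (coshDcos_bound _)); rewrite normrM (ger0_norm h0) exprMn.
rewrite mulrA [leRHS]mulrAC ler_wpM2l ?mulr_ge0 ?exprn_ge0//.
by rewrite ler_expR ler_piMr.
Qed.

(** A discrete maximum principle. The added e x^2 raises the four-point sum by 2 e h^2, which
    absorbs the cubic error and four times the gap to the supremum. The strip is unbounded, so the
    supremum need not be attained and a nearly extremal point is used instead. *)
Lemma three_lines_unit g mu :
  (forall y, cabs (expsum g mu 0 y) <= 1) ->
  (forall y, cabs (expsum g mu 1 y) <= 1) ->
  forall x y, 0 <= x <= 1 -> cabs (expsum g mu x y) <= 1.
Proof.
move=> G0 G1 x0 y0 x001; apply/ler_addgt0Pr => e' e'0.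
pose e := Num.min (e' / 2) 1.
have e0 : 0 < e by rewrite lt_min divr_gt0//=.
have [e1 ee'] : e <= 1 /\ 2 * e <= e'.
  by rewrite /e; case: (leP (e' / 2) 1) => ?; split; lra.
have [K KP] := expsum_bounded g mu.
have [L [L0 LP]] := expsum_lipschitz g mu.
have [M [M0 MP]] := expsum_average g mu.
pose v x y := cabs (expsum g mu x y) + e * x ^+ 2.
pose E := [set s | exists x y, 0 <= x <= 1 /\ s = v x y]%classic.
have x2le x : 0 <= x <= 1 -> 0 <= x ^+ 2 <= 1.
  by move=> /andP[? ?]; rewrite exprn_ge0//= exprn_ile1.
have ubE : ubound E (K + 1).
  move=> _ [x [y [x01 ->]]]; apply: lerD; first exact: KP.
  have := x2le x x01 => /andP[? ?]; nra.
have supE : has_sup E.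
  by split; [exists (v x0 y0), x0, y0|exists (K + 1)].
have leS x y : 0 <= x <= 1 -> v x y <= sup E.
  by move=> x01; apply: ub_le_sup; [exists (K + 1)|exists x, y].
suff S2 : sup E <= 1 + 2 * e.
  have := leS x0 y0 x001; rewrite /v; have /andP[+ _] := x2le x0 x001.
  move=> x020 Gx0; have : 0 <= e * x0 ^+ 2 by rewrite mulr_ge0// ltW.
  by lra.
rewrite leNgt; apply/negP => S2.
(* With this step, h L <= e / 2 controls the loss near an edge and h M <= e / 2 keeps the cubic
   error below e h^2. *)
pose h := e / (2 * (1 + L + M)).
have LM : 0 < 2 * (1 + L + M) by lra.
have h0 : 0 < h by rewrite divr_gt0.
have he : h * (1 + L + M) = e / 2 by rewrite /h; field; rewrite gt_eqF//; lra.
have hL : 0 <= h * L by rewrite mulr_ge0// ltW.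
have hM : 0 <= h * M by rewrite mulr_ge0// ltW.
have hh : h <= e / 2 by lra.
have h2 : h ^+ 2 <= 1 / 4 by nra.
have h20 : 0 < h ^+ 2 by rewrite exprn_gt0.
have eta : 0 < e * h ^+ 2 / 4 by rewrite divr_gt0// mulr_gt0.
have eta1 : e * h ^+ 2 / 4 <= e / 4 by nra.
have [_ [x [y [x01 ->]]] vS] := sup_adherent eta supE.
have /andP[x20 x21] := x2le x x01.
have ex2 : e * x ^+ 2 <= e by nra.
move/andP: (x01) => [xge0 xle1].
(* Within h of an edge the Lipschitz bound gives v <= 1 + e / 2 + e, which is too small for a nearly
   extremal point. *)
have [xh|hx] := ltP x h.
  have := LP x 0 y x01; rewrite lexx ler01 subr0 (ger0_norm xge0) => /(_ isT).
  have := G0 y; have : L * x <= h * L by rewrite mulrC ler_wpM2r// ltW.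
  by move: vS; rewrite /v; nra.
have [xh|xh] := ltP (1 - h) x.
  have := LP x 1 y x01; rewrite lexx ler01 distrC ger0_norm ?subr_ge0// => /(_ isT).
  have := G1 y.
  have : L * (1 - x) <= h * L by rewrite mulrC ler_wpM2r//; lra.
  by move: vS; rewrite /v; nra.
have h01 : 0 <= h <= 1 by apply/andP; split; lra.
have := MP x y h x01 h01.
have xph01 : 0 <= x + h <= 1 by apply/andP; split; lra.
have xmh01 : 0 <= x - h <= 1 by apply/andP; split; lra.
have := leS _ y xph01; have := leS _ y xmh01.
have := leS x (y + h) x01; have := leS x (y - h) x01.
have hm3 : M * h ^+ 3 <= e * h ^+ 2.
  have -> : M * h ^+ 3 = (h * M) * h ^+ 2 by ring.
  by rewrite ler_wpM2r ?ltW//; lra.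
move: vS; rewrite /v.
have -> : e * (x + h) ^+ 2 = e * x ^+ 2 + 2 * (e * x * h) + e * h ^+ 2 by ring.
have -> : e * (x - h) ^+ 2 = e * x ^+ 2 - 2 * (e * x * h) + e * h ^+ 2 by ring.
lra.
Qed.

(** Multiplying by M0^(z-1) M1^(-z) makes both edge bounds 1. That factor is an exponential, so the
    product is again an exponential sum, with every frequency moved by ln M0 - ln M1. *)
Lemma three_lines g mu (M0 M1 : R) : 0 < M0 -> 0 < M1 ->
  (forall y, cabs (expsum g mu 0 y) <= M0) ->
  (forall y, cabs (expsum g mu 1 y) <= M1) ->
  forall x y, 0 <= x <= 1 ->
  cabs (expsum g mu x y) <= M0 `^ (1 - x) * M1 `^ x.
Proof.
move=> M00 M10 G0 G1 x y x01.
pose l := ln M0 - ln M1.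
pose g' i := g i * (M0^-1)%:C%C; pose mu' i := mu i + l.
have gg' a b : expsum g' mu' a b =
    expsum g mu a b * (expR (l * a) / M0)%:C%C * cis (l * b).
  rewrite /expsum !mulr_suml; apply: eq_bigr => i _.
  rewrite /g' /mu' !(mulrDl (mu i)) cisD expRD !rmorphM/=.
  by ring.
have cgg' a b : cabs (expsum g' mu' a b) =
    cabs (expsum g mu a b) / (M0 `^ (1 - a) * M1 `^ a).
  rewrite gg' !cabsM cabs_cis mulr1 cabs_real ger0_norm; last first.
    by rewrite divr_ge0 ?expR_ge0// ltW.
  congr (_ * _); rewrite /powR !gt_eqF// -expRD -expRN.
  have -> : M0^-1 = expR (- ln M0) by rewrite expRN lnK ?posrE.
  by rewrite -expRD; congr expR; rewrite /l; ring.
have := @three_lines_unit g' mu' _ _ x y x01; rewrite cgg' ler_pdivrMr ?mul1r.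
  apply=> z; rewrite cgg' ler_pdivrMr ?mulr_gt0 ?powR_gt0// mul1r.
    by rewrite subr0 powRr1 ?(ltW M00)// powRr0 mulr1.
  by rewrite subrr powRr1 ?(ltW M10)// powRr0 mul1r.
by rewrite mulr_gt0 ?powR_gt0.
Qed.

End ThreeLines.

(** * Frobenius norm and contractions *)

(** Lagrange's identity: twice the difference of the two sides is the sum over i, j of (a_i b_j -
    a_j b_i)^2. *)
Lemma sum_mul_sqr_le (R : realFieldType) (I : finType) (a b : I -> R) :
  (\sum_i a i * b i) ^+ 2 <= (\sum_i a i ^+ 2) * (\sum_i b i ^+ 2).
Proof.
have : 0 <= \sum_i \sum_j (a i * b j - a j * b i) ^+ 2.
  by apply: sumr_ge0 => i _; apply: sumr_ge0 => j _; exact: sqr_ge0.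
have -> : \sum_i \sum_j (a i * b j - a j * b i) ^+ 2 =
    ((\sum_i a i ^+ 2) * (\sum_i b i ^+ 2) - (\sum_i a i * b i) ^+ 2) *+ 2.
  transitivity (\sum_i \sum_j a i ^+ 2 * b j ^+ 2 + \sum_i \sum_j b i ^+ 2 * a j ^+ 2
      - 2 * \sum_i \sum_j (a i * b i) * (a j * b j)).
    rewrite mulr_sumr -big_split/= -sumrB; apply: eq_bigr => i _.
    by rewrite mulr_sumr -big_split/= -sumrB; apply: eq_bigr => j _; ring.
  by rewrite -!big_distrlr/=; ring.
by rewrite pmulrn_lge0// subr_ge0.
Qed.

Section Frobenius.
Variable R : realType.

Definition frob2 (m n : nat) (A : 'M[R[i]]_(m, n)) : R :=
  \sum_i \sum_j cabs (A i j) ^+ 2.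

Lemma frob2_ge0 m n (A : 'M[R[i]]_(m, n)) : 0 <= frob2 A.
Proof. by apply: sumr_ge0 => i _; apply: sumr_ge0 => j _; exact: sqr_ge0. Qed.

Lemma cabs_conj (z : R[i]) : cabs z^* = cabs z.
Proof. by case: z => a b; rewrite /cabs /= sqrrN. Qed.

Lemma cabs_sqr (z : R[i]) : (cabs z ^+ 2)%:C%C = z * z^*.
Proof. by rewrite rmorphXn/= -cabsE normCK. Qed.

Definition adjmx m n (A : 'M[R[i]]_(m, n)) : 'M[R[i]]_(n, m) :=
  \matrix_(i, j) (A j i)^*.

Lemma adjmxM m n p (A : 'M[R[i]]_(m, n)) (B : 'M[R[i]]_(n, p)) :
  adjmx (A *m B) = adjmx B *m adjmx A.
Proof.
apply/matrixP => i j; rewrite !mxE rmorph_sum; apply: eq_bigr => k _.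
by rewrite !mxE rmorphM mulrC.
Qed.

Lemma adjmxK m n (A : 'M[R[i]]_(m, n)) : adjmx (adjmx A) = A.
Proof. by apply/matrixP => i j; rewrite !mxE conjCK. Qed.

Lemma adjmxD m n (A B : 'M[R[i]]_(m, n)) : adjmx (A + B) = adjmx A + adjmx B.
Proof. by apply/matrixP => i j; rewrite !mxE rmorphD. Qed.

Lemma adjmxB m n (A B : 'M[R[i]]_(m, n)) : adjmx (A - B) = adjmx A - adjmx B.
Proof. by apply/matrixP => i j; rewrite !mxE rmorphB. Qed.

Lemma adjmxZ m n a (A : 'M[R[i]]_(m, n)) : adjmx (a *: A) = a^* *: adjmx A.
Proof. by apply/matrixP => i j; rewrite !mxE rmorphM. Qed.

Lemma adjmx_diag_real n (w : 'I_n -> R) :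
  adjmx (diag_mx (\row_i (w i)%:C%C)) = diag_mx (\row_i (w i)%:C%C).
Proof.
apply/matrixP => i j; rewrite !mxE eq_sym; case: eqP => [->|_] /=.
  by rewrite !mulr1n; apply/CrealP; rewrite complex_real.
by rewrite !mulr0n rmorph0.
Qed.

Lemma frob2E m n (A : 'M[R[i]]_(m, n)) : (frob2 A)%:C%C = \tr (A *m adjmx A).
Proof.
rewrite rmorph_sum; apply: eq_bigr => i _; rewrite rmorph_sum mxE.
by apply: eq_bigr => j _; rewrite /= cabs_sqr !mxE.
Qed.

Lemma frob2_adjmx m n (A : 'M[R[i]]_(m, n)) : frob2 (adjmx A) = frob2 A.
Proof.
rewrite /frob2 exchange_big/=; apply: eq_bigr => i _; apply: eq_bigr => j _.
by rewrite !mxE cabs_conj.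
Qed.

Lemma frob_Cauchy_Schwarz m n (A : 'M[R[i]]_(m, n)) (B : 'M[R[i]]_(n, m)) :
  cabs (\tr (A *m B)) ^+ 2 <= frob2 A * frob2 B.
Proof.
have -> : frob2 B = \sum_i \sum_j cabs (B j i) ^+ 2 by rewrite /frob2 exchange_big.
rewrite /frob2 !pair_big/=.
apply: le_trans (sum_mul_sqr_le _ _); rewrite lerXn2r ?nnegrE ?cabs_ge0//.
  by apply: sumr_ge0 => ij _; rewrite mulr_ge0 ?cabs_ge0.
have -> : \tr (A *m B) = \sum_ij A ij.1 ij.2 * B ij.2 ij.1.
  by rewrite -(pair_bigA _ (fun i j => A i j * B j i)); apply: eq_bigr => i _; rewrite mxE.
by apply: le_trans (cabs_sum _) _; apply: ler_sum => ij _; rewrite cabsM.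
Qed.

End Frobenius.

(** * Contractions for the operator norm *)

Section Contractions.
Variables (R : realType) (d : nat).
Implicit Types (A U V W : 'M[R[i]]_d) (w : 'rV[R[i]]_d).

(** Operator norm at most 1, tested on matrices in the Frobenius norm rather than on vectors; asking
    for both sides lets a factor be stripped from either end of a product. *)
Definition mx_contraction W := forall A,
  frob2 (A *m W) <= frob2 A /\ frob2 (W *m A) <= frob2 A.

Lemma contractionM U V : mx_contraction U -> mx_contraction V -> mx_contraction (U *m V).
Proof.
move=> cU cV A; rewrite mulmxA -(mulmxA U V); split.
  exact: le_trans (cV _).1 (cU _).1.
exact: le_trans (cU _).2 (cV _).2.
Qed.

(** With B = A W and B' its adjoint, Cauchy-Schwarz gives |B|^2 = tr (A W B') <= |A| |W B'| <= |A|
    |B|, and |B| cancels unless it is 0. *)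
Lemma contraction_left W : (forall A, frob2 (W *m A) <= frob2 A) -> mx_contraction W.
Proof.
move=> cW A; split=> //.
have := frob_Cauchy_Schwarz A (W *m adjmx (A *m W)).
rewrite mulmxA -frob2E cabs_real ger0_norm ?frob2_ge0// expr2.
have := cW (adjmx (A *m W)); rewrite frob2_adjmx.
have := frob2_ge0 (A *m W); rewrite le_eqVlt => /predU1P[<- _ _|x0 h1 h2].
  exact: frob2_ge0.
by rewrite -(ler_pM2r x0) (le_trans h2)// ler_wpM2l ?frob2_ge0.
Qed.

Lemma contraction_adjmx W : mx_contraction W -> mx_contraction (adjmx W).
Proof.
move=> cW A; split.
  by rewrite -frob2_adjmx adjmxM adjmxK -[leRHS]frob2_adjmx; exact: (cW _).2.
by rewrite -frob2_adjmx adjmxM adjmxK -[leRHS]frob2_adjmx; exact: (cW _).1.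
Qed.

Lemma frob2_diag_mul w A :
  frob2 (diag_mx w *m A) = \sum_i cabs (w 0 i) ^+ 2 * \sum_j cabs (A i j) ^+ 2.
Proof.
apply: eq_bigr => i _; rewrite mulr_sumr; apply: eq_bigr => j _.
by rewrite mul_diag_mx mxE cabsM exprMn.
Qed.

Lemma contraction_diag w : (forall i, cabs (w 0 i) <= 1) -> mx_contraction (diag_mx w).
Proof.
move=> w1; apply: contraction_left => A; rewrite frob2_diag_mul.
apply: ler_sum => i _; rewrite ler_piMl ?exprn_ile1 ?cabs_ge0//.
by apply: sumr_ge0 => j _; exact: sqr_ge0.
Qed.

Lemma contraction_partial_isometry W (S : pred 'I_d) :
  adjmx W *m W = diag_mx (\row_i ((S i)%:R : R)%:C%C) -> mx_contraction W.
Proof.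
move=> WW; apply: contraction_left => A; set D := diag_mx _ in WW.
have -> : frob2 (W *m A) = frob2 (D *m A).
  apply: complexI; rewrite -frob2_adjmx -[in RHS]frob2_adjmx !frob2E !adjmxM !adjmxK.
  rewrite -!mulmxA (mulmxA (adjmx W)) WW; congr (\tr (_ *m _)).
  rewrite mulmxA; congr (_ *m _); rewrite adjmx_diag_real mulmx_diag; congr diag_mx.
  by apply/rowP => i; rewrite !mxE -rmorphM -natrM mulnb andbb.
apply: (contraction_diag _ A).2 => i; rewrite mxE cabs_real.
by case: (S i); rewrite ?normr1 ?normr0.
Qed.

Lemma contraction_unitary W : adjmx W *m W = 1%:M -> mx_contraction W.
Proof.
move=> uW; apply: (@contraction_partial_isometry _ predT).
by rewrite uW -diag_const_mx; congr diag_mx; apply/rowP => i; rewrite !mxE.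
Qed.

Lemma contraction_entry W i j : mx_contraction W -> cabs (W i j) <= 1.
Proof.
move=> /(_ (delta_mx i i))[+ _].
have -> : frob2 (delta_mx i i : 'M[R[i]]_d) = 1.
  rewrite /frob2 (bigD1 i)//= (bigD1 i)//= mxE !eqxx/= cabs1 expr1n.
  rewrite !big1 ?addr0// => k ki.
    by apply: big1 => l _; rewrite mxE (negbTE ki)/= cabs0 expr0n.
  by rewrite mxE (negbTE ki) andbF cabs0 expr0n.
move=> h; rewrite -(@expr_le1 _ 2) ?cabs_ge0//; apply: le_trans h.
rewrite /frob2 (bigD1 i)//= (bigD1 j)//= -addrA ler_wpDr//.
  apply: addr_ge0; first by apply: sumr_ge0 => k _; exact: sqr_ge0.
  by apply: sumr_ge0 => k _; apply: sumr_ge0 => l _; exact: sqr_ge0.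
suff -> : (delta_mx i i *m W) i j = W i j by [].
rewrite mxE (bigD1 i)//= mxE !eqxx mul1r big1 ?addr0// => k ki.
by rewrite mxE (negbTE ki) andbF mul0r.
Qed.

End Contractions.

(** * The trilinear commutator form *)

Section SpectralFamilies.
Variables (R : realType) (d : nat).
Implicit Types (U V W : 'M[R[i]]_d) (e : 'I_d -> R[i]) (lam : 'I_d -> R).

(** The first condition is the operator norm bound at exponent 0, the last one the trace norm bound
    at exponent 1; lam_i <= 0 allows a path to be restarted at a larger exponent. *)
Definition admissible e lam : Prop :=
  [/\ forall i, cabs (e i) <= 1, forall i, lam i <= 0
    & \sum_i cabs (e i) * expR (lam i) <= 1].

Definition expdiag e lam (a : R) : 'rV[R[i]]_d :=
  \row_i (e i * (expR (a * lam i))%:C%C).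

Lemma expdiagE e lam a i : expdiag e lam a 0 i = e i * (expR (a * lam i))%:C%C.
Proof. by rewrite mxE. Qed.

(* The path a |-> U diag(e_i exp(a lam_i)) V runs from the unit ball of the
   operator norm (a = 0) to that of the trace norm (a = 1); at a it stays in
   the unit ball of the Schatten (1/a)-norm. *)
Definition schatten_path (F : R -> 'M[R[i]]_d) : Prop :=
  exists U V e lam, [/\ mx_contraction U, mx_contraction V, admissible e lam
    & F = fun a => U *m diag_mx (expdiag e lam a) *m V].

(** An imaginary displacement of the exponent only changes the phases of e, so a bound valid for all
    paths extends to a whole vertical line. *)
Lemma admissible_cis e lam (y : R) : admissible e lam ->
  admissible (fun i => e i * cis (y * lam i)) lam.
Proof.
move=> [e1 l0 s1]; split=> // [i|]; first by rewrite cabsM cabs_cis mulr1.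
by under eq_bigr do rewrite cabsM cabs_cis mulr1.
Qed.

Lemma admissible_shift e lam (b : R) : 0 <= b -> admissible e lam ->
  admissible (fun i => e i * (expR (b * lam i))%:C%C) lam.
Proof.
move=> b0 [e1 l0 s1].
have le i : cabs (e i * (expR (b * lam i))%:C%C) <= cabs (e i).
  rewrite cabsM cabs_real ger0_norm ?expR_ge0// ler_piMr ?cabs_ge0//.
  by rewrite -expR0 ler_expR mulr_ge0_le0.
split=> // [i|]; first exact: le_trans (e1 i).
by apply: le_trans s1; apply: ler_sum => i _; rewrite ler_wpM2r ?expR_ge0.
Qed.

Lemma schatten_pathP U V e lam :
  mx_contraction U -> mx_contraction V -> admissible e lam ->
  schatten_path (fun a => U *m diag_mx (expdiag e lam a) *m V).
Proof. by move=> cU cV ad; exists U, V, e, lam. Qed.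

Lemma schatten_path_shift F (b : R) : 0 <= b -> schatten_path F ->
  schatten_path (fun a => F (a + b)).
Proof.
move=> b0 [U [V [e [lam [cU cV ad ->]]]]].
exists U, V, (fun i => e i * (expR (b * lam i))%:C%C), lam.
split; [exact: cU|exact: cV|exact: admissible_shift|].
apply/funext => a; congr (_ *m diag_mx _ *m _).
by apply/rowP => i; rewrite !mxE mulrDl expRD rmorphM mulrAC mulrA.
Qed.

Lemma cabs_expdiag e lam a i :
  cabs (expdiag e lam a 0 i) = cabs (e i) * expR (a * lam i).
Proof. by rewrite mxE cabsM cabs_real ger0_norm ?expR_ge0. Qed.

Lemma schatten_path0 F : schatten_path F -> mx_contraction (F 0).
Proof.
move=> [U [V [e [lam [cU cV [e1 _ _] ->]]]]].
apply: contractionM => //; apply: contractionM => //.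
by apply: contraction_diag => i; rewrite cabs_expdiag mul0r expR0 mulr1.
Qed.

(** The squared diagonal entries are |e_i|^2 exp(lam_i) <= |e_i| exp(lam_i), because |e_i| <= 1. *)
Lemma schatten_path_half F : schatten_path F -> frob2 (F 2^-1) <= 1.
Proof.
move=> [U [V [e [lam [cU cV [e1 _ s1] ->]]]]].
apply: le_trans (cV _).1 _; apply: le_trans (cU _).2 _.
rewrite -[diag_mx _]mulmx1 frob2_diag_mul; apply: le_trans s1.
apply: ler_sum => i _; rewrite cabs_expdiag (bigD1 i)//= big1 => [|j ji]; last first.
  by rewrite mxE eq_sym (negbTE ji) cabs0 expr0n.
rewrite mxE eqxx cabs1 expr1n addr0 mulr1 exprMn -expRM_natl mulrA divff ?pnatr_eq0//.
by rewrite mul1r ler_wpM2r ?expR_ge0// expr2 ler_piMl ?cabs_ge0.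
Qed.

Lemma schatten_path1 F W : schatten_path F -> mx_contraction W ->
  cabs (\tr (F 1 *m W)) <= 1.
Proof.
move=> [U [V [e [lam [cU cV [e1 _ s1] ->]]]]] cW.
rewrite -!mulmxA mxtrace_mulC -!mulmxA; set K := V *m _.
have cK : mx_contraction K by do 2?apply: contractionM.
apply: le_trans s1; apply: le_trans (cabs_sum _) _; apply: ler_sum => i _.
rewrite mul_diag_mx mxE cabsM cabs_expdiag mul1r ler_piMr//.
  by rewrite mulr_ge0 ?cabs_ge0 ?expR_ge0.
exact: contraction_entry.
Qed.

Definition comm_form (Z X Y : 'M[R[i]]_d) : R := cabs (\tr (Z *m (X *m Y - Y *m X))).

(** The first exponent is the dual one, 1 - 1/p in the application. Quantifying over paths instead
    of unit balls is what allows the exponents to be moved. *)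
Definition comm_bound (a b c M : R) : Prop := forall F G H,
  schatten_path F -> schatten_path G -> schatten_path H ->
  comm_form (F a) (G b) (H c) <= M.

(** A path restarted at a later exponent is again a path, so [F a'] is also the value at [a] of
    another path. *)
Lemma comm_bound_mono a b c a' b' c' M : a <= a' -> b <= b' -> c <= c' ->
  comm_bound a b c M -> comm_bound a' b' c' M.
Proof.
move=> aa' bb' cc' P F G H sF sG sH.
have shift K x y : x <= y -> schatten_path K -> exists2 K', schatten_path K' & K y = K' x.
  move=> xy sK; exists (fun z => K (z + (y - x))); last by rewrite subrKC.
  by apply: schatten_path_shift; rewrite ?subr_ge0.
have [F' sF' ->] := shift F a a' aa' sF.
have [G' sG' ->] := shift G b b' bb' sG.
have [H' sH' ->] := shift H c c' cc' sH.
exact: P.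
Qed.

Lemma mxtrace_diag3 (w1 w2 w3 : 'rV[R[i]]_d) (A B C : 'M[R[i]]_d) :
  \tr (diag_mx w1 *m A *m diag_mx w2 *m B *m diag_mx w3 *m C) =
  \sum_i \sum_j \sum_k w1 0 i * w2 0 j * w3 0 k * (A i j * B j k * C k i).
Proof.
apply: eq_bigr => i _; rewrite -!mulmxA mul_diag_mx !mxE mulr_sumr.
apply: eq_bigr => j _; rewrite mul_diag_mx !mxE 2!mulr_sumr mulr_sumr.
by apply: eq_bigr => k _; rewrite mul_diag_mx !mxE; ring.
Qed.

(** Each term contains one entry of each diagonal, and the contractions only contribute constants;
    this turns the form into an exponential sum. *)
Lemma mxtrace_sandwich3 (w1 w2 w3 : 'rV[R[i]]_d) (U1 V1 U2 V2 U3 V3 : 'M[R[i]]_d) :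
  \tr (U1 *m diag_mx w1 *m V1 *m
        (U2 *m diag_mx w2 *m V2 *m (U3 *m diag_mx w3 *m V3))) =
  \sum_i \sum_j \sum_k w1 0 i * w2 0 j * w3 0 k *
    ((V1 *m U2) i j * (V2 *m U3) j k * (V3 *m U1) k i).
Proof.
rewrite -mxtrace_diag3 -(mulmxA U1) -(mulmxA U1) mxtrace_mulC.
by congr (\tr _); rewrite !mulmxA.
Qed.

(** Along the segment of exponents the form is an exponential sum. At x + iy it is the form of three
    other paths, whose e carries extra phases, so the two hypotheses bound it on both edges of the
    strip. *)
Lemma comm_bound_interpolate a0 b0 c0 M0 a1 b1 c1 M1 t :
  0 < M0 -> 0 < M1 -> 0 <= t <= 1 ->
  comm_bound a0 b0 c0 M0 -> comm_bound a1 b1 c1 M1 ->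
  comm_bound ((1 - t) * a0 + t * a1) ((1 - t) * b0 + t * b1)
    ((1 - t) * c0 + t * c1) (M0 `^ (1 - t) * M1 `^ t).
Proof.
move=> M00 M10 t01 P0 P1 F G H.
move=> [U1 [V1 [e1 [l1 [cU1 cV1 ad1 ->]]]]].
move=> [U2 [V2 [e2 [l2 [cU2 cV2 ad2 ->]]]]].
move=> [U3 [V3 [e3 [l3 [cU3 cV3 ad3 ->]]]]].
(* The two terms come from tr (Z X Y) and tr (Z Y X), indexed so that i, j, k belong to Z, X, Y in
   both. *)
pose coef i j k := (V1 *m U2) i j * (V2 *m U3) j k * (V3 *m U1) k i
  - (V1 *m U3) i k * (V3 *m U2) k j * (V2 *m U1) j i.
pose mu i j k := (a1 - a0) * l1 i + (b1 - b0) * l2 j + (c1 - c0) * l3 k.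
pose g i j k := coef i j k * (e1 i * e2 j * e3 k) *
  (expR (a0 * l1 i + b0 * l2 j + c0 * l3 k))%:C%C.
pose I := ('I_d * ('I_d * 'I_d))%type.
have key x y : cabs (expsum (fun i : I => g i.1 i.2.1 i.2.2)
                       (fun i : I => mu i.1 i.2.1 i.2.2) x y) =
  comm_form
    (U1 *m diag_mx (expdiag (fun i => e1 i * cis (y * (a1 - a0) * l1 i)) l1
       ((1 - x) * a0 + x * a1)) *m V1)
    (U2 *m diag_mx (expdiag (fun i => e2 i * cis (y * (b1 - b0) * l2 i)) l2
       ((1 - x) * b0 + x * b1)) *m V2)
    (U3 *m diag_mx (expdiag (fun i => e3 i * cis (y * (c1 - c0) * l3 i)) l3
       ((1 - x) * c0 + x * c1)) *m V3).
  rewrite /comm_form; congr cabs; rewrite mulmxBr raddfB/=.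
  set w1 := expdiag _ l1 _; set w2 := expdiag _ l2 _; set w3 := expdiag _ l3 _.
  rewrite !mxtrace_sandwich3.
  rewrite /expsum -(pair_bigA _ (fun i jk => g i jk.1 jk.2 *
     (expR (mu i jk.1 jk.2 * x))%:C%C * cis (mu i jk.1 jk.2 * y)))/=.
  rewrite -sumrB; apply: eq_bigr => i _.
  rewrite -(pair_bigA _ (fun j k => g i j k *
     (expR (mu i j k * x))%:C%C * cis (mu i j k * y)))/=.
  rewrite [X in _ - X]exchange_big/= -sumrB; apply: eq_bigr => j _.
  rewrite -sumrB; apply: eq_bigr => k _.
  rewrite /w1 /w2 /w3 !expdiagE /g /mu.
  have -> : ((a1 - a0) * l1 i + (b1 - b0) * l2 j + (c1 - c0) * l3 k) * x =
    (a1 - a0) * l1 i * x + (b1 - b0) * l2 j * x + (c1 - c0) * l3 k * x by ring.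
  have -> : ((a1 - a0) * l1 i + (b1 - b0) * l2 j + (c1 - c0) * l3 k) * y =
    y * (a1 - a0) * l1 i + y * (b1 - b0) * l2 j + y * (c1 - c0) * l3 k by ring.
  have -> : ((1 - x) * a0 + x * a1) * l1 i =
    a0 * l1 i + (a1 - a0) * l1 i * x by ring.
  have -> : ((1 - x) * b0 + x * b1) * l2 j =
    b0 * l2 j + (b1 - b0) * l2 j * x by ring.
  have -> : ((1 - x) * c0 + x * c1) * l3 k =
    c0 * l3 k + (c1 - c0) * l3 k * x by ring.
  rewrite !expRD !cisD !rmorphM/= /coef.
  by ring.
have := three_lines M00 M10 _ _ 0 t01; rewrite -/I => /(_ I).
have -> : comm_form (U1 *m diag_mx (expdiag e1 l1 ((1 - t) * a0 + t * a1)) *m V1)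
  (U2 *m diag_mx (expdiag e2 l2 ((1 - t) * b0 + t * b1)) *m V2)
  (U3 *m diag_mx (expdiag e3 l3 ((1 - t) * c0 + t * c1)) *m V3) =
  cabs (expsum (fun i : I => g i.1 i.2.1 i.2.2)
                       (fun i : I => mu i.1 i.2.1 i.2.2) t 0).
  rewrite key.
  have E e l (z : R) : (fun i : 'I_d => e i * cis (0 * z * l i)) = e.
    by apply/funext => i; rewrite !mul0r cis0 mulr1.
  by rewrite !E.
apply.
- move=> y; rewrite key subr0 !mul1r !mul0r !addr0.
  exact: (P0 _ _ _ (schatten_pathP cU1 cV1 (admissible_cis _ ad1))
    (schatten_pathP cU2 cV2 (admissible_cis _ ad2))
    (schatten_pathP cU3 cV3 (admissible_cis _ ad3))).
- move=> y; rewrite key subrr !mul1r !mul0r !add0r.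
  exact: (P1 _ _ _ (schatten_pathP cU1 cV1 (admissible_cis _ ad1))
    (schatten_pathP cU2 cV2 (admissible_cis _ ad2))
    (schatten_pathP cU3 cV3 (admissible_cis _ ad3))).
Qed.

Lemma comm_form_le (Z X Y : 'M[R[i]]_d) :
  comm_form Z X Y <= cabs (\tr (Z *m X *m Y)) + cabs (\tr (Z *m Y *m X)).
Proof.
rewrite /comm_form mulmxBr raddfB/= !mulmxA.
by rewrite (le_trans (le_normcD _ _))// /cabs normcN.
Qed.

Lemma comm_bound100 : comm_bound 1 0 0 2.
Proof.
move=> F G H sF /schatten_path0 cG /schatten_path0 cH.
by apply: le_trans (comm_form_le _ _ _) _; rewrite -!mulmxA;
  apply: lerD; apply: schatten_path1 => //; exact: contractionM.
Qed.

Lemma comm_bound010 : comm_bound 0 1 0 2.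
Proof.
move=> F G H /schatten_path0 cF sG /schatten_path0 cH.
apply: le_trans (comm_form_le _ _ _) _; apply: lerD.
  by rewrite mxtrace_mulC mulmxA mxtrace_mulC; apply: schatten_path1 => //; exact: contractionM.
by rewrite mxtrace_mulC; apply: schatten_path1 => //; exact: contractionM.
Qed.

Lemma comm_bound001 : comm_bound 0 0 1 2.
Proof.
move=> F G H /schatten_path0 cF /schatten_path0 cG sH.
apply: le_trans (comm_form_le _ _ _) _; apply: lerD.
  by rewrite mxtrace_mulC; apply: schatten_path1 => //; exact: contractionM.
by rewrite mxtrace_mulC mulmxA mxtrace_mulC; apply: schatten_path1 => //; exact: contractionM.
Qed.

Lemma comm_bound000 : comm_bound 0 0 0 (2 * d%:R).
Proof.
move=> F G H /schatten_path0 cF /schatten_path0 cG /schatten_path0 cH.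
have trle W : mx_contraction W -> cabs (\tr W) <= d%:R.
  move=> cW; apply: le_trans (cabs_sum _) _.
  rewrite -[d in leRHS]card_ord -sumr_const.
  by apply: ler_sum => i _; exact: contraction_entry.
apply: le_trans (comm_form_le _ _ _) _; rewrite mulr_natl mulr2n.
by apply: lerD; apply: trle; do 2?apply: contractionM.
Qed.

End SpectralFamilies.

(** * The Boettcher-Wenzel inequality *)

Section BoettcherWenzel.
Variables (R : realType) (d : nat).
Implicit Types (X Y A B : 'M[R[i]]_d).

Lemma adjmx_tC m n (A : 'M[R[i]]_(m, n)) : A^t* = adjmx A.
Proof. by apply/matrixP => i j; rewrite !mxE. Qed.

Lemma spectral_hermitian A : adjmx A = A ->
  [/\ spectralmx A *m adjmx (spectralmx A) = 1%:M,
      adjmx (spectralmx A) *m spectralmx A = 1%:M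
    & A = adjmx (spectralmx A) *m diag_mx (spectral_diag A) *m spectralmx A].
Proof.
move=> hA; set P := spectralmx A.
have uP : P \is unitarymx by exact: spectral_unitarymx.
have PP : P *m adjmx P = 1%:M by rewrite -adjmx_tC; exact/unitarymxP.
have nA : A \is normalmx by apply/normalmxP; rewrite adjmx_tC hA.
split; [exact: PP|exact: mulmx1C|].
by rewrite -adjmx_tC -(invmx_unitary uP); exact/orthomx_spectralP.
Qed.

Lemma hermitian_diag A : adjmx A = A -> exists (P : 'M[R[i]]_d) (a : 'I_d -> R),
  [/\ P *m adjmx P = 1%:M, adjmx P *m P = 1%:M
    & A = adjmx P *m diag_mx (\row_i (a i)%:C%C) *m P].
Proof.
move=> hA; have [PP PP' AE] := spectral_hermitian hA.
exists (spectralmx A), (fun i => complex.Re (spectral_diag A 0 i)); split=> //.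
rewrite {1}AE; congr (_ *m diag_mx _ *m _); apply/rowP => i.
rewrite [RHS]mxE RRe_real//; apply/CrealP.
set P := spectralmx A in PP PP' AE; set D := diag_mx _ in AE.
have hD : D = P *m A *m adjmx P by rewrite AE !mulmxA PP mul1mx -mulmxA PP mulmx1.
have := congr1 (fun M : 'M[R[i]]_d => adjmx M i i) hD.
by rewrite !adjmxM adjmxK hA mulmxA -hD !mxE eqxx !mulr1n.
Qed.

(** The left side is the sum of p_i p_j (a_i - a_j)^2. Off the diagonal (a_i - a_j)^2 <= 2 (a_i^2 +
    a_j^2), and then 4 p_i (T - p_i) <= T^2. For T = 1 the variance is thus at most half of the sum
    of a_i^2. *)
Lemma weighted_variance (I : finType) (p a : I -> R) : (forall i, 0 <= p i) ->
  2 * ((\sum_i p i) * (\sum_i p i * a i ^+ 2) - (\sum_i p i * a i) ^+ 2) <=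
  (\sum_i p i) ^+ 2 * \sum_i a i ^+ 2.
Proof.
move=> p0; set T := \sum_i p i.
have -> : 2 * (T * (\sum_i p i * a i ^+ 2) - (\sum_i p i * a i) ^+ 2) =
    \sum_i \sum_j p i * p j * (a i - a j) ^+ 2.
  transitivity (\sum_i \sum_j p i * (p j * a j ^+ 2) +
      \sum_i \sum_j (p i * a i ^+ 2) * p j
      - 2 * \sum_i \sum_j (p i * a i) * (p j * a j)).
    by rewrite -!big_distrlr/= -/T; ring.
  rewrite mulr_sumr -big_split/= -sumrB; apply: eq_bigr => i _.
  by rewrite mulr_sumr -big_split/= -sumrB; apply: eq_bigr => j _; ring.
apply: (@le_trans _ _ (\sum_i \sum_(j | j != i) (2 * (p i * a i ^+ 2) * p j) +
    \sum_i \sum_(j | j != i) (2 * (p j * a j ^+ 2) * p i))).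
  rewrite -big_split/=; apply: ler_sum => i _.
  rewrite (bigD1 i)//= subrr expr0n mulr0 add0r -big_split/=.
  apply: ler_sum => j _.
  have -> : 2 * (p i * a i ^+ 2) * p j + 2 * (p j * a j ^+ 2) * p i =
    p i * p j * (2 * (a i ^+ 2 + a j ^+ 2)) by ring.
  rewrite ler_wpM2l ?mulr_ge0//.
  by have := sqr_ge0 (a i + a j); nra.
have -> : \sum_i \sum_(j | j != i) (2 * (p j * a j ^+ 2) * p i) =
    \sum_i \sum_(j | j != i) (2 * (p i * a i ^+ 2) * p j).
  rewrite [LHS](exchange_big_dep predT)//=; apply: eq_bigr => i _.
  by apply: eq_bigl => j; rewrite eq_sym.
rewrite -big_split/= mulr_sumr; apply: ler_sum => i _.
rewrite -big_distrr/=.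
have -> : \sum_(j | j != i) p j = T - p i by rewrite [T](bigD1 i)//= addrAC subrr add0r.
have -> : 2 * (p i * a i ^+ 2) * (T - p i) + 2 * (p i * a i ^+ 2) * (T - p i) =
  (4 * p i * (T - p i)) * a i ^+ 2 by ring.
rewrite ler_wpM2r ?sqr_ge0//.
by have := sqr_ge0 (T - 2 * p i); nra.
Qed.

(** Divided by its trace 2 |Y|^2, this is the density matrix under which the variances are taken. *)
Definition sym_gram Y : 'M[R[i]]_d := Y *m adjmx Y + adjmx Y *m Y.

(** In an eigenbasis of A the diagonal entries of [sym_gram Y] are nonnegative weights of total 2
    |Y|^2; u and v are the first and second moments of the eigenvalues of A under these weights. *)
Lemma hermitian_variance A Y : adjmx A = A -> exists u v : R,
  [/\ \tr (A *m sym_gram Y) = u%:C%C, \tr (A *m A *m sym_gram Y) = v%:C%C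
    & 2 * (2 * frob2 Y * v - u ^+ 2) <= (2 * frob2 Y) ^+ 2 * frob2 A].
Proof.
move=> /hermitian_diag[P [a [PP PP' ->]]].
set D := diag_mx _.
pose p i := \sum_j (cabs ((P *m Y) i j) ^+ 2 + cabs ((P *m adjmx Y) i j) ^+ 2).
have p0 i : 0 <= p i by apply: sumr_ge0 => j _; rewrite addr_ge0 ?sqr_ge0.
have diagE i : (P *m sym_gram Y *m adjmx P) i i = (p i)%:C%C.
  have -> : P *m sym_gram Y *m adjmx P =
      (P *m Y) *m adjmx (P *m Y) + (P *m adjmx Y) *m adjmx (P *m adjmx Y).
    by rewrite !adjmxM adjmxK mulmxDr mulmxDl !mulmxA.
  rewrite mxE mxE [X in _ + X]mxE -big_split/= rmorph_sum; apply: eq_bigr => j _.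
  by rewrite rmorphD/= !cabs_sqr !mxE.
have trP (M : 'M[R[i]]_d) : \tr (adjmx P *m M *m P) = \tr M.
  by rewrite mxtrace_mulC mulmxA PP mul1mx.
have psum : \sum_i p i = 2 * frob2 Y.
  apply: complexI; rewrite rmorph_sum/= -(eq_bigr _ (fun i _ => diagE i)).
  rewrite -/(\tr _) mxtrace_mulC mulmxA PP' mul1mx raddfD/=.
  rewrite [X in _ + X]mxtrace_mulC -frob2E rmorphM/= rmorph_nat.
  by rewrite mulr_natl mulr2n.
have trD (w : 'I_d -> R) :
    \tr (adjmx P *m diag_mx (\row_i (w i)%:C%C) *m P *m sym_gram Y) =
    (\sum_i p i * w i)%:C%C.
  rewrite -mulmxA -mulmxA mxtrace_mulC -mulmxA rmorph_sum; apply: eq_bigr => i _.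
  by rewrite mul_diag_mx mxE diagE mxE rmorphM mulrC.
exists (\sum_i p i * a i), (\sum_i p i * a i ^+ 2); split.
- by rewrite trD.
- rewrite -trD; congr (\tr (_ *m _)); rewrite !mulmxA.
  rewrite -(mulmxA _ P) PP mulmx1 -(mulmxA (adjmx P)) mulmx_diag.
  congr (_ *m diag_mx _ *m _).
  by apply/rowP => i; rewrite !mxE -rmorphM.
have -> : frob2 (adjmx P *m D *m P) = \sum_i a i ^+ 2.
  apply: complexI; rewrite frob2E !adjmxM adjmxK !mulmxA -(mulmxA _ P) PP mulmx1.
  rewrite -(mulmxA (adjmx P)) trP adjmx_diag_real mulmx_diag rmorph_sum.
  by apply: eq_bigr => i _; rewrite !mxE eqxx mulr1n -rmorphM.
by rewrite -psum; exact: weighted_variance.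
Qed.

Lemma mxtrace_commutator_identity (a b a' b' : 'M[R[i]]_d) :
  \tr ((a *m b - b *m a) *m (b' *m a' - a' *m b')) +
  \tr ((a' *m b + b *m a') *m (b' *m a + a *m b')) =
  \tr ((a' *m a + a *m a') *m (b *m b' + b' *m b)).
Proof.
have cyc (A B C D : 'M[R[i]]_d) :
    \tr (A *m B *m (C *m D)) = \tr (B *m C *m (D *m A)).
  by rewrite -mulmxA mxtrace_mulC mulmxA -!mulmxA.
have trD (A B C D : 'M[R[i]]_d) : \tr ((A + B) *m (C + D)) =
    \tr (A *m C) + \tr (A *m D) + (\tr (B *m C) + \tr (B *m D)).
  by rewrite mulmxDl !mulmxDr !raddfD.
have trB (A B C D : 'M[R[i]]_d) : \tr ((A - B) *m (C - D)) =
    \tr (A *m C) - \tr (A *m D) - (\tr (B *m C) - \tr (B *m D)).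
  by rewrite mulmxBl !mulmxBr !raddfB.
rewrite trB !trD (cyc a' a b b') (cyc b a' a b') (cyc a a' b b') (cyc b a a' b').
rewrite (cyc a b a' b') (cyc a' b a b').
move: (\tr (a *m b *m (b' *m a'))) (\tr (a *m a' *m (b' *m b))) => t1 t2.
move: (\tr (b *m a' *m (b' *m a))) (\tr (b *m a *m (b' *m a'))) => t3 t4.
move: (\tr (a' *m b *m (b' *m a))) (\tr (a' *m a *m (b' *m b))) => t5 t6.
by ring.
Qed.

(** An exact trade-off: bounding the commutator from above amounts to bounding from below the
    anticommutator of Y with the adjoint of X. *)
Lemma frob2_commutator X Y :
  (frob2 (X *m Y - Y *m X) + frob2 (adjmx X *m Y + Y *m adjmx X))%:C%C =
  \tr ((adjmx X *m X + X *m adjmx X) *m sym_gram Y).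
Proof.
by rewrite rmorphD/= !frob2E adjmxB adjmxD !adjmxM adjmxK mxtrace_commutator_identity.
Qed.

Lemma frob2_eq0 (m n : nat) (A : 'M[R[i]]_(m, n)) : frob2 A = 0 -> A = 0.
Proof.
move=> A0; apply/matrixP => i j; rewrite mxE; apply: Normc.eq0_normc.
move/eqP : A0; rewrite psumr_eq0 => [/allP/(_ i)|k _]; last first.
  by apply: sumr_ge0 => l _; exact: sqr_ge0.
rewrite mem_index_enum => /(_ isT)/=; rewrite psumr_eq0 => [/allP/(_ j)|l _]; last first.
  exact: sqr_ge0.
by rewrite mem_index_enum => /(_ isT)/=; rewrite sqrf_eq0 => /eqP.
Qed.

Let imag : R[i] := (0 +i* 1)%C.

Let imagM : imag * imag = -1.
Proof. by apply/eqP; rewrite eq_complex/= !mul0r mulr0 mulr1 addr0 sub0r oppr0 !eqxx. Qed.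

Let imagC : imag^* = - imag.
Proof. by apply/eqP; rewrite eq_complex/= oppr0 !eqxx. Qed.

Lemma cartesian_decomposition X : exists A B : 'M[R[i]]_d,
  [/\ adjmx A = A, adjmx B = B & X = A + imag *: B].
Proof.
exists (2^-1 *: (X + adjmx X)), ((2^-1 * - imag) *: (X - adjmx X)); split.
- by rewrite adjmxZ adjmxD adjmxK addrC fmorphV/= conjC_nat.
- rewrite adjmxZ adjmxB adjmxK rmorphM rmorphN/= fmorphV/= conjC_nat imagC opprK.
  by rewrite mulrN scaleNr -scalerN opprB.
- rewrite scalerA mulrCA mulrN imagM opprK mulr1 -scalerDr.
  by rewrite addrACA subrr addr0 -mulr2n -(scaler_nat 2 X) scalerA mulVf ?scale1r// pnatr_eq0.
Qed.

Lemma Boettcher_Wenzel X Y :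
  frob2 (X *m Y - Y *m X) <= 2 * frob2 X * frob2 Y.
Proof.
have [A [B [hA hB XE]]] := cartesian_decomposition X.
have [u1 [v1 [u1E v1E le1]]] := hermitian_variance Y hA.
have [u2 [v2 [u2E v2E le2]]] := hermitian_variance Y hB.
have XsE : adjmx X = A - imag *: B by rewrite XE adjmxD adjmxZ imagC hA hB scaleNr.
have XX : adjmx X *m X + X *m adjmx X = 2 *: (A *m A) + 2 *: (B *m B).
  rewrite XsE XE !(mulmxBl, mulmxBr, mulmxDl, mulmxDr).
  rewrite -!(scalemxAl, scalemxAr).
  move: (A *m A) (A *m B) (B *m A) (B *m B) => M1 M2 M3 M4.
  by apply/matrixP => i j; rewrite !mxE; ring: imagM.
have FX : frob2 X = frob2 A + frob2 B.
  apply: complexI; rewrite rmorphD/= !frob2E hA hB.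
  have := congr1 mxtrace XX; rewrite raddfD/= mxtrace_mulC raddfD/= !linearZ/=.
  rewrite -mulr2n -[LHS](mulr_natl _ 2) -mulrDr => /mulfI; apply.
  by rewrite pnatr_eq0.
have := frob2_commutator X Y; rewrite XX mulmxDl mxtraceD -2!scalemxAl 2!mxtraceZ.
rewrite v1E v2E; set F := frob2 _; set G := frob2 _ => FG.
have {}FG : F + G = 2 * v1 + 2 * v2.
  by apply: complexI; rewrite FG rmorphD !rmorphM/= rmorph_nat.
(* Testing the anticommutator against the adjoint of Y yields the conjugated mean u1 - i u2, so
   Cauchy-Schwarz supplies exactly the squared means that the variances subtract. *)
have uG : u1 ^+ 2 + u2 ^+ 2 <= frob2 Y * G.
  have := frob_Cauchy_Schwarz (adjmx Y) (adjmx X *m Y + Y *m adjmx X).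
  have -> : \tr (adjmx Y *m (adjmx X *m Y + Y *m adjmx X)) = (u1 -i* u2)%C.
    transitivity (\tr (adjmx X *m sym_gram Y)).
      rewrite !mulmxDr !raddfD/= mxtrace_mulC -mulmxA; congr (_ + _).
      by rewrite mulmxA mxtrace_mulC.
    rewrite XsE mulmxBl -scalemxAl raddfB/= linearZ/= u1E u2E.
    by apply/eqP; rewrite eq_complex/=; apply/andP; split; apply/eqP; ring.
  by rewrite frob2_adjmx /cabs/= sqrrN sqr_sqrtr// addr_ge0 ?sqr_ge0.
(* The final estimate is multiplied through by |Y|^2, which has to be positive to cancel. *)
have N0 := frob2_ge0 Y; move: N0; rewrite le_eqVlt => /predU1P[/esym/frob2_eq0 Y0|N0].
  rewrite {1}/F Y0 mulmx0 mul0mx subrr.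
  have -> : frob2 (0 : 'M[R[i]]_d) = 0.
    by apply: big1 => i _; apply: big1 => j _; rewrite mxE cabs0 expr0n.
  by rewrite mulr0.
rewrite -(ler_pM2l N0) FX; nra.
Qed.

Lemma comm_bound_half : @comm_bound R d 2^-1 2^-1 2^-1 (2 `^ 2^-1).
Proof.
move=> F G H /schatten_path_half F1 /schatten_path_half G1 /schatten_path_half H1.
set Z := F _ in F1 *; set X := G _ in G1 *; set Y := H _ in H1 *.
rewrite powR12_sqrt// -(ler_pXn2r (_ : 0 < 2)%N) ?nnegrE ?cabs_ge0 ?sqrtr_ge0//.
rewrite sqr_sqrtr//; apply: le_trans (frob_Cauchy_Schwarz _ _) _.
have := Boettcher_Wenzel X Y.
have := frob2_ge0 X; have := frob2_ge0 Y; have := frob2_ge0 Z.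
have := frob2_ge0 (X *m Y - Y *m X).
move=> W0 Z0 Y0 X0 BW; apply: le_trans (_ : 1 * (2 * frob2 X * frob2 Y) <= _).
  exact: ler_pM.
nra.
Qed.

End BoettcherWenzel.

(** * Interpolation between the known exponents *)

Section CommutatorRegions.
Variables (R : realType) (d : nat).
Implicit Types a b c m : R.

Let lt02 : 0 < 2 :> R. Proof. by rewrite ltr0n. Qed.

Lemma comm_bound_eq a b c M a' b' c' M' : comm_bound d a b c M ->
  a = a' -> b = b' -> c = c' -> M = M' -> comm_bound d a' b' c' M'.
Proof. by move=> + <- <- <- <-. Qed.

(** Two interpolations: along the edge c = 0, then from a point of that edge to (0, 0, 1). *)
Lemma comm_bound_simplex a b c : 0 <= a -> 0 <= b -> 0 <= c -> a + b + c = 1 ->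
  comm_bound d a b c 2.
Proof.
move=> a0 b0 c0 abc.
have two t : (2 : R) = 2 `^ (1 - t) * 2 `^ t.
  by rewrite -powRD ?pnatr_eq0 ?implybT// subrK powRr1.
have [c1|c1] := eqVneq c 1.
  by apply: (comm_bound_eq (@comm_bound001 R d)) => //; lra.
have ab0 : 0 < a + b.
  rewrite lt_def addr_ge0// andbT; apply: contra_neq c1 => ab; lra.
have t01 : 0 <= b / (a + b) <= 1.
  by rewrite divr_ge0 ?addr_ge0//= ler_pdivrMr//; lra.
have edge := comm_bound_interpolate lt02 lt02 t01
  (@comm_bound100 R d) (@comm_bound010 R d).
have c01 : 0 <= c <= 1 by apply/andP; split; lra.
have edge2 : comm_bound d (a / (a + b)) (b / (a + b)) 0 2.
  apply: (comm_bound_eq edge); rewrite -?two ?mulr1 ?mulr0 ?addr0 ?add0r//.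
  by field; lra.
apply: (comm_bound_eq (comm_bound_interpolate lt02 lt02 c01 edge2
  (@comm_bound001 R d))); rewrite -?two//.
- by have -> : 1 - c = a + b by [lra]; field; lra.
- by have -> : 1 - c = a + b by [lra]; field; lra.
- lra.
Qed.

(** On the segment from the origin to the face s = 1 the weights are 1 - s and s, and (2 d)^(1-s)
    2^s = 2 d^(1-s). *)
Lemma comm_bound_Hoelder a b c : (0 < d)%N -> 0 <= a -> 0 <= b -> 0 <= c ->
  a + b + c <= 1 -> comm_bound d a b c (2 * d%:R `^ (1 - (a + b + c))).
Proof.
move=> d0 a0 b0 c0; set s := a + b + c => s1.
have dR : 0 < d%:R :> R by rewrite ltr0n.
have [s0|s0] := eqVneq s 0.
  apply: (comm_bound_eq (@comm_bound000 R d)); rewrite ?s0 ?subr0 ?powRr1 ?ler0n//;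
    by move: s0; rewrite /s; lra.
have {}s0 : 0 < s by rewrite lt_def s0 /s !addr_ge0.
have s01 : 0 <= s <= 1 by rewrite s1 ltW.
have face : comm_bound d (a / s) (b / s) (c / s) 2.
  by apply: comm_bound_simplex; rewrite ?divr_ge0 ?(ltW s0)// -!mulrDl divff ?gt_eqF.
apply: (comm_bound_eq (comm_bound_interpolate (mulr_gt0 lt02 dR) lt02 s01
  (@comm_bound000 R d) face)). - by field; lra.
- by field; lra.
- by field; lra.
- rewrite powRM ?ler0n// mulrAC -powRD ?pnatr_eq0 ?implybT//.
  by rewrite subrK powRr1.
Qed.

(** Since s is 1 on the face of the unit vectors and 3/2 at (1/2, 1/2, 1/2), the latter gets weight
    t = 2 (s - 1), and 2^(1-t) 2^(t/2) = 2^(2-s). At s = 3/2 there is no remaining weight on the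
    face. *)
Lemma comm_bound_tetrahedron a b c :
  a + b <= 1 -> a + c <= 1 -> b + c <= 1 -> 1 <= a + b + c ->
  comm_bound d a b c (2 `^ (2 - (a + b + c))).
Proof.
set s := a + b + c => ab ac bc s1.
have [s32|s32] := eqVneq s (3 / 2).
  apply: (comm_bound_eq (@comm_bound_half R d)); rewrite ?s32;
    try by [move: s32; rewrite /s; lra].
  by congr (_ `^ _); lra.
have {}s32 : s < 3 / 2.
  by rewrite lt_neqAle s32/=; rewrite /s; lra.
pose t := 2 * (s - 1).
have t01 : 0 <= t <= 1 by rewrite /t; apply/andP; split; lra.
have t1 : 0 < 1 - t by rewrite /t; lra.
pose w x := (x - t / 2) / (1 - t).
have face : comm_bound d (w a) (w b) (w c) 2.
  apply: comm_bound_simplex; rewrite /w ?divr_ge0 ?(ltW t1)//;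
    rewrite ?subr_ge0 /t /s; try lra.
  by rewrite -!mulrDl; apply: (canLR (mulfK (lt0r_neq0 t1))); rewrite /t /s; lra.
have h : (0 : R) < 2 `^ 2^-1 by rewrite powR_gt0.
apply: (comm_bound_eq (comm_bound_interpolate lt02 h t01 face (@comm_bound_half R d))).
- by rewrite /w; field; lra.
- by rewrite /w; field; lra.
- by rewrite /w; field; lra.
- rewrite -powRrM -powRD ?pnatr_eq0 ?implybT//; congr (_ `^ _).
  by rewrite /t; lra.
Qed.

Lemma comm_bound_region a b c m : 0 <= a -> 0 <= b -> 0 <= c ->
  1 <= a + b + c -> ~ [/\ 2^-1 < a, 2^-1 < b & 2^-1 < c] ->
  1 - a <= m -> 1 - b <= m -> 1 - c <= m -> 2 - (a + b + c) <= m ->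
  comm_bound d a b c (2 `^ m).
Proof.
move=> a0 b0 c0 s1 nabc am bm cm sm.
have main a' b' c' : a' <= a -> b' <= b -> c' <= c ->
    a' + b' <= 1 -> a' + c' <= 1 -> b' + c' <= 1 -> 1 <= a' + b' + c' ->
    2 - (a' + b' + c') <= m -> comm_bound d a b c (2 `^ m).
  move=> aa bb cc ab ac bc s1' sm' F G H sF sG sH.
  apply: le_trans (comm_bound_mono aa bb cc (comm_bound_tetrahedron ab ac bc s1') sF sG sH) _.
  by rewrite ler_powR// ler1n.
(* The two larger coordinates can be lowered until their sum is 1. *)
have shrink (x y z : R) : z <= x -> z <= y -> z <= 2^-1 -> 1 < x + y ->
    exists x' y', [/\ x' <= x, y' <= y, x' + y' = 1, z <= x' & z <= y'].
  (* Stopping at 1 - z keeps the other coordinate at least z, and z <= 1/2 keeps 1 - z itself at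
     least z. The new total is 1 + z, with exponent 1 - z. *)
  move=> zx zy z2 xy; exists (Num.min x (1 - z)), (1 - Num.min x (1 - z)).
  by case: (leP x (1 - z)) => h; split; lra.
have [ca|ac] := leP c a; have [cb|bc] := leP c b.
- have [ab|ab] := leP (a + b) 1; first by apply: (main a b c) => //; lra.
  have c2 : c <= 2^-1 by rewrite leNgt; apply/negP => ?; apply: nabc; split; lra.
  have [x [y [xa yb xy cx cy]]] := shrink a b c ca cb c2 ab.
  by apply: (main x y c) => //; lra.
- have [ac|ac] := leP (a + c) 1; first by apply: (main a b c) => //; lra.
  have b2 : b <= 2^-1 by rewrite leNgt; apply/negP => ?; apply: nabc; split; lra.
  have ba : b <= a by lra.
  have [x [y [xa yb xy cx cy]]] := shrink a c b ba (ltW bc) b2 ac.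
  by apply: (main x b y) => //; lra.
- have [bc|bc] := leP (b + c) 1; first by apply: (main a b c) => //; lra.
  have a2 : a <= 2^-1 by rewrite leNgt; apply/negP => ?; apply: nabc; split; lra.
  have ab : a <= b by lra.
  have [x [y [xa yb xy cx cy]]] := shrink b c a ab (ltW ac) a2 bc.
  by apply: (main a x y) => //; lra.
- have [ba|ab] := leP b a.
    have [ac'|ac'] := leP (a + c) 1; first by apply: (main a b c) => //; lra.
    have b2 : b <= 2^-1 by rewrite leNgt; apply/negP => ?; apply: nabc; split; lra.
    have [x [y [xa yb xy cx cy]]] := shrink a c b ba (ltW bc) b2 ac'.
    by apply: (main x b y) => //; lra.
  have [bc'|bc'] := leP (b + c) 1; first by apply: (main a b c) => //; lra.
  have a2 : a <= 2^-1 by rewrite leNgt; apply/negP => ?; apply: nabc; split; lra.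
  have [x [y [xa yb xy cx cy]]] := shrink b c a (ltW ab) (ltW ac) a2 bc'.
  by apply: (main a x y) => //; lra.
Qed.

End CommutatorRegions.

(** * Singular values and duality *)

Section SingularValues.
Variables (R : realType) (d : nat).
Implicit Types (X Y : 'M[R[i]]_d).

(** Left unsorted, so that the index agrees with the eigenbasis in the factorization of X. *)
Definition singval X (i : 'I_d) : R :=
  Num.sqrt (complex.Re (spectral_diag (adjmx X *m X) 0 i)).

Lemma singval_ge0 X i : 0 <= singval X i.
Proof. exact: sqrtr_ge0. Qed.

Lemma singular_valuesE X :
  singular_values X = sort >=%R [seq singval X i | i <- enum 'I_d].
Proof. by rewrite /singular_values adjmx_tC. Qed.

Lemma gram_diag X (P := spectralmx (adjmx X *m X)) :
  [/\ P *m adjmx P = 1%:M, adjmx P *m P = 1%:M &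
  adjmx (X *m adjmx P) *m (X *m adjmx P) = diag_mx (\row_i (singval X i ^+ 2)%:C%C)].
Proof.
have hX : adjmx (adjmx X *m X) = adjmx X *m X by rewrite adjmxM adjmxK.
have [PP PP' XE] := spectral_hermitian hX; rewrite -/P in PP PP' XE.
split=> //; have DE : adjmx (X *m adjmx P) *m (X *m adjmx P) =
    diag_mx (spectral_diag (adjmx X *m X)).
  rewrite adjmxM adjmxK !mulmxA -(mulmxA P) {1}XE !mulmxA PP mul1mx.
  by rewrite -mulmxA PP mulmx1.
rewrite DE; congr diag_mx; apply/rowP => i; rewrite mxE /singval.
have : 0 <= spectral_diag (adjmx X *m X) 0 i.
  have := congr1 (fun M : 'M[R[i]]_d => M i i) DE.
  rewrite [in RHS]mxE eqxx mulr1n mxE => <-; apply: sumr_ge0 => k _.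
  by rewrite mxE mulrC -cabs_sqr ler0c sqr_ge0.
move=> s0; rewrite sqr_sqrtr; first by rewrite RRe_real ?ger0_real.
by move: s0; rewrite lecE => /andP[].
Qed.

(** In an eigenbasis of the Gram matrix the columns of X are orthogonal, with the singular values as
    lengths. Dividing by the lengths gives U, only a partial isometry when X is singular. *)
Lemma singular_value_decomposition X : exists U V : 'M[R[i]]_d,
  [/\ mx_contraction U, mx_contraction V, V *m adjmx V = 1%:M,
      adjmx U *m U = diag_mx (\row_i ((singval X i != 0)%:R : R)%:C%C) &
      X = U *m diag_mx (\row_i (singval X i)%:C%C) *m V].
Proof.
have [PP PP' BB] := gram_diag X.
set P := spectralmx _ in PP PP' BB; set B := X *m adjmx P in BB.
have BP : B *m P = X by rewrite -mulmxA PP' mulmx1.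
(* As the inverse of 0 is 0, this is the pseudoinverse of the diagonal of singular values. *)
clearbody B; pose W := diag_mx (\row_i ((singval X i)^-1)%:C%C).
have UU : adjmx (B *m W) *m (B *m W) =
    diag_mx (\row_i ((singval X i != 0)%:R : R)%:C%C).
  rewrite adjmxM -mulmxA (mulmxA (adjmx B)) BB adjmx_diag_real !mulmx_diag.
  congr diag_mx; apply/rowP => i; rewrite !mxE -!rmorphM/=; congr (_%:C%C).
  have [->|s0] := eqVneq (singval X i) 0; first by rewrite invr0 mul0r.
  by rewrite /=; field.
exists (B *m W), P; split=> //.
- exact: contraction_partial_isometry UU.
- exact: contraction_unitary.
- rewrite -(mulmxA B) mulmx_diag; set E := diag_mx _.
  have -> : B *m E = B; last by rewrite BP.
  apply/matrixP => k i; rewrite mul_mx_diag !mxE -rmorphM/=.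
  have [s0|s0] := eqVneq (singval X i) 0; last by rewrite mulVf// mulr1.
  rewrite s0 invr0 mul0r mulr0; apply/esym/Normc.eq0_normc.
  have := congr1 (fun M : 'M[R[i]]_d => M i i) BB.
  rewrite [in RHS]mxE eqxx mulr1n [in RHS]mxE s0 expr0n mxE => /eqP.
  rewrite psumr_eq0 => [/allP/(_ k)|j _]; last first.
    by rewrite mxE mulrC -cabs_sqr ler0c sqr_ge0.
  rewrite mem_index_enum => /(_ isT)/=.
  rewrite mxE mulrC -cabs_sqr => /eqP/complexI/eqP.
  by rewrite sqrf_eq0 => /eqP.
Qed.

Lemma schatten_norm_fin (p : R) X :
  schatten_norm p%:E X = (\sum_i singval X i `^ p) `^ p^-1.
Proof.
rewrite /schatten_norm singular_valuesE; congr (_ `^ _).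
by rewrite (perm_big _ (permEl (perm_sort _ _)))/= big_map big_enum.
Qed.

Lemma schatten_norm_infty_ge X i : singval X i <= schatten_norm +oo X.
Proof.
rewrite /schatten_norm singular_valuesE; set s := sort _ _.
have : singval X i \in s by rewrite mem_sort map_f// mem_enum.
have : sorted >=%R s by apply: sort_sorted => x y; exact: le_total.
case: s => // x s /= xs; rewrite inE => /predU1P[->//|].
by have /allP := order_path_min (rev_trans le_trans) xs; exact.
Qed.

Lemma schatten_norm_infty_attained X : (0 < d)%N ->
  exists i, schatten_norm +oo X = singval X i.
Proof.
move=> d0; rewrite /schatten_norm singular_valuesE; set s := sort _ _.
have : head 0 s \in s.
  suff : (0 < size s)%N by case: s => // x s _; rewrite mem_head.
  by rewrite size_sort size_map size_enum_ord.
by rewrite mem_sort => /mapP[i _ ->]; exists i.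
Qed.

Lemma schatten_norm_ge0 (p : \bar R) X : (0 < d)%N -> 0 <= schatten_norm p X.
Proof.
move=> d0; case: p => [p||//]; first by rewrite schatten_norm_fin powR_ge0.
by have [i ->] := schatten_norm_infty_attained X d0; exact: singval_ge0.
Qed.

Lemma rinv_fin (p : R) : 0 < p -> rinv p%:E = p^-1.
Proof. by move=> p0; rewrite /rinv inver gt_eqF. Qed.

(** For finite p and x_i = [singval X i] / N, the choice lam_i = p ln x_i gives x_i at exponent 1/p
    and x_i^(p-1) at exponent 1 - 1/p, the vector attaining equality in Hoelder's inequality. *)
Lemma schatten_norm_data (p : \bar R) X (N := schatten_norm p X) :
  (0 < d)%N -> (1 <= p)%E ->
  (exists (e lam : 'I_d -> R), admissible (fun i => (e i)%:C%C) lam /\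
     forall i, singval X i = N * (e i * expR (rinv p * lam i))) /\
  (exists (e lam : 'I_d -> R), admissible (fun i => (e i)%:C%C) lam /\
     \sum_i singval X i * (e i * expR ((1 - rinv p) * lam i)) = N).
Proof.
move=> d0 p1; have N0 : 0 <= N by exact: schatten_norm_ge0.
have [Nz|Nnz] := eqVneq N 0.
  have s0 i : singval X i = 0.
    case: p p1 @N Nz {N0} => [p p1 N|_ N|//]; last first.
      move=> Nz; apply/eqP; rewrite eq_le singval_ge0 andbT -Nz.
      exact: schatten_norm_infty_ge.
    rewrite /N schatten_norm_fin => /powR_eq0_eq0/eqP.
    rewrite psumr_eq0 => [/allP/(_ i)|j _]; last exact: powR_ge0.
    by rewrite mem_index_enum => /(_ isT)/= /eqP /powR_eq0_eq0.
  split; exists (fun=> 0), (fun=> 0); (split; [split=> //=|]).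
  - by move=> i; rewrite cabs0.
  - by rewrite big1// => i _; rewrite cabs0 mul0r.
  - by move=> i; rewrite s0 Nz mul0r.
  - by move=> i; rewrite cabs0.
  - by rewrite big1// => i _; rewrite cabs0 mul0r.
  - by rewrite Nz big1// => i _; rewrite mul0r mulr0.
have {N0}Ngt0 : 0 < N by rewrite lt_def Nnz.
case: p p1 @N Nnz Ngt0 => [p p1 N Nnz Ngt0|_ N Nnz Ngt0|//]; last first.
  rewrite /rinv invey/=; split.
    (* At exponent 0 the value of lam does not show; - ln d makes each of the d terms of the
       admissibility sum at most 1/d. *)
    exists (fun i => singval X i / N), (fun=> - ln d%:R); split; last first.
      by move=> i; rewrite mul0r expR0 mulr1 mulrC divfK.
    have e1 i : cabs (singval X i / N)%:C%C <= 1.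
      rewrite cabs_real ger0_norm ?divr_ge0 ?singval_ge0 ?(ltW Ngt0)//.
      by rewrite ler_pdivrMr// mul1r schatten_norm_infty_ge.
    split=> //.
      by move=> _; rewrite oppr_le0 ln_ge0// ler1n.
    rewrite -mulr_suml expRN lnK ?posrE ?ltr0n// ler_pdivrMr ?ltr0n// mul1r.
    rewrite -[d in leRHS]card_ord -sumr_const.
    exact: ler_sum.
  have [i0 NE] := schatten_norm_infty_attained X d0.
  exists (fun i => (i == i0)%:R), (fun=> 0); split.
    split=> //.
      by move=> i; rewrite cabs_real; case: eqP; rewrite ?normr1 ?normr0.
    rewrite (bigD1 i0)//= eqxx cabs_real normr1 mul1r expR0 big1 ?addr0//.
    by move=> i /negbTE ->; rewrite cabs_real normr0 mul0r.
  rewrite (bigD1 i0)//= eqxx mulr0 expR0 !mulr1 big1 ?addr0//.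
  by move=> i /negbTE ->; rewrite mul0r mulr0.
have pgt0 : 0 < p by rewrite (lt_le_trans ltr01).
have pE : rinv p%:E = p^-1 by exact: rinv_fin.
pose x i := singval X i / N.
have x0 i : 0 <= x i by rewrite divr_ge0 ?singval_ge0// ltW.
have xp : \sum_i x i `^ p = 1.
  under eq_bigr do rewrite powRM ?singval_ge0 ?invr_ge0 ?(ltW Ngt0)//.
  rewrite -mulr_suml -(powR_inv1 (ltW Ngt0)) -powRrM mulN1r powRN /N.
  rewrite schatten_norm_fin -powRrM mulVf ?gt_eqF// powRr1 ?divff//; last first.
    by apply: sumr_ge0 => i _; exact: powR_ge0.
  apply: contra_neq Nnz => S0.
  by rewrite /N schatten_norm_fin S0 powR0// invr_eq0 gt_eqF.
have x1 i : x i <= 1.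
  rewrite leNgt; apply/negP => xi; move: xp; apply/eqP; rewrite gt_eqF//.
  rewrite (bigD1 i)//= ltr_wpDr//.
    by apply: sumr_ge0 => j _; exact: powR_ge0.
  by rewrite -(powRr0 (x i)) /powR gt_eqF ?(lt_trans _ xi)// ltr_expR mul0r mulr_gt0// ln_gt0.
pose e i : R := (singval X i != 0)%:R.
pose lam i := p * ln (x i).
(* Exponent zero is excluded because [powR] sends 0 to the power 0 to 1, while e vanishes at a zero
   singular value. It occurs for p = 1, treated apart below. *)
have xe i (c : R) : c * p != 0 -> e i * expR (c * lam i) = x i `^ (c * p).
  move=> c0; rewrite /e /lam /x; have [->|s0] := eqVneq (singval X i) 0.
    by rewrite mul0r mul0r powR0.
  by rewrite mul1r /powR mulf_eq0 invr_eq0 (negbTE s0) (negbTE Nnz)/= mulrA.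
have ad : admissible (fun i => (e i)%:C%C) lam.
  split.
  - by move=> i; rewrite cabs_real /e; case: eqP; rewrite ?normr1 ?normr0.
  - by move=> i; rewrite mulr_ge0_le0 ?(ltW pgt0)// ln_le0.
  - rewrite le_eqVlt -xp; apply/orP; left; apply/eqP; apply: eq_bigr => i _.
    rewrite cabs_real ger0_norm ?ler0n// -[lam i]mul1r xe mul1r//.
    by rewrite gt_eqF.
split; exists e, lam; split=> //; rewrite pE.
  by move=> i; rewrite xe mulVf ?gt_eqF ?oner_eq0// powRr1// /x mulrC divfK.
rewrite -[RHS]mulr1 -[in RHS]xp mulr_sumr; apply: eq_bigr => i _.
have [p1'|p1'] := eqVneq ((1 - p^-1) * p) 0.
  have {}p1' : p = 1.
    by move: p1'; rewrite mulrBl mul1r mulVf ?gt_eqF// => /eqP; rewrite subr_eq0 => /eqP.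
  rewrite p1' invr1 subrr mul0r expR0 mulr1 powRr1// /e /x.
  have [->|_] := eqVneq (singval X i) 0; first by rewrite !mul0r mulr0.
  by rewrite mulr1 mulrC divfK.
rewrite xe// mulrBl mul1r mulVf ?gt_eqF//.
rewrite -{1}(divfK Nnz (singval X i)) -/(x i) mulrAC mulrC.
by rewrite mulr_powRB1.
Qed.

Lemma schatten_norm_path (q : \bar R) X : (0 < d)%N -> (1 <= q)%E ->
  exists2 G : R -> 'M[R[i]]_d, schatten_path G &
    X = (schatten_norm q X)%:C%C *: G (rinv q).
Proof.
move=> d0 q1; have [[e [lam [ad se]]] _] := schatten_norm_data X d0 q1.
have [U [V [cU cV _ _ XE]]] := singular_value_decomposition X.
eexists; first exact: schatten_pathP cU cV ad.
rewrite {1}XE scalemxAl scalemxAr; congr (_ *m _ *m _).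
apply/matrixP => i j; rewrite !mxE se !rmorphM/=.
by case: eqP => _; rewrite ?mulr1n// !mulr0n mulr0.
Qed.

(** For X = U S V the dual matrix is V' D U', with primes for adjoints and D the diagonal attaining
    equality. The trace becomes tr (U' U S D), and the zero-one diagonal U' U is absorbed by S. *)
Lemma schatten_norm_dual (p : \bar R) X : (0 < d)%N -> (1 <= p)%E ->
  exists2 F : R -> 'M[R[i]]_d, schatten_path F &
    \tr (F (1 - rinv p) *m X) = (schatten_norm p X)%:C%C.
Proof.
move=> d0 p1; have [_ [e [lam [ad se]]]] := schatten_norm_data X d0 p1.
have [U [V [cU cV VV UU XE]]] := singular_value_decomposition X.
eexists.
  exact: schatten_pathP (contraction_adjmx cV) (contraction_adjmx cU) ad.
have cyc (D S : 'M[R[i]]_d) :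
    \tr (adjmx V *m D *m adjmx U *m (U *m S *m V)) = \tr (adjmx U *m U *m S *m D).
  rewrite mxtrace_mulC !mulmxA -(mulmxA (U *m S) V) VV mulmx1.
  by rewrite mxtrace_mulC !mulmxA.
have := cyc _ (diag_mx (\row_i (singval X i)%:C%C)); rewrite -XE => ->.
rewrite UU !mulmx_diag -se rmorph_sum.
apply: eq_bigr => i _; rewrite !mxE eqxx mulr1n -!rmorphM/=; congr (_%:C%C).
have [->|_] := eqVneq (singval X i) 0; first by rewrite !(mulr0, mul0r).
by rewrite mul1r.
Qed.

Lemma comm_bound_commutator_bounds (p q r : \bar R) (M : R) : (0 < d)%N ->
  (1 <= p)%E -> (1 <= q)%E -> (1 <= r)%E ->
  comm_bound d (1 - rinv p) (rinv q) (rinv r) M -> commutator_bounds d p q r M.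
Proof.
move=> d0 p1 q1 r1 cb X Y.
have [F sF] := schatten_norm_dual (X *m Y - Y *m X) d0 p1.
have [G sG XE] := schatten_norm_path X d0 q1.
have [H sH YE] := schatten_norm_path Y d0 r1.
have NX := schatten_norm_ge0 q X d0; have NY := schatten_norm_ge0 r Y d0.
have := schatten_norm_ge0 p (X *m Y - Y *m X) d0.
have := cb F G H sF sG sH.
move: (schatten_norm p (_ - _)) => N FGH N0.
rewrite {1 2}XE {1 2}YE -!scalemxAl -!scalemxAr !scalerA [_ * (schatten_norm q X)%:C%C]mulrC.
rewrite -scalerBr -scalemxAr mxtraceZ -rmorphM/= => /(congr1 (@cabs R)).
rewrite cabsM !cabs_real !ger0_norm ?mulr_ge0// => <-.
rewrite -mulrA mulrC ler_wpM2r ?mulr_ge0//.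
Qed.

End SingularValues.

(** * Extremal matrices *)

Section LowerBounds.
Variables (R : realType) (d : nat).
Implicit Types (X Y : 'M[R[i]]_d) (w : 'I_d -> R) (s : 'I_d -> 'I_d).

(** The equation for M makes every squared singular value a root of x^2 = c^2 x, so each singular
    value is 0 or c; the trace says that k of them are c. *)
Lemma schatten_norm_flat (p : \bar R) X (c : R) (k : nat) : (1 <= p)%E ->
  0 < c -> (0 < k)%N -> let M := adjmx X *m X in
  M *m M = (c ^+ 2)%:C%C *: M -> \tr M = (c ^+ 2 * k%:R)%:C%C ->
  schatten_norm p X = c * k%:R `^ rinv p.
Proof.
move=> p1 c0 k0 M MM trM; have [PP PP' BB] := gram_diag X.
set P := spectralmx _ in PP PP' BB; set D := diag_mx _ in BB.
have c2 : c ^+ 2 != 0 by rewrite sqrf_eq0 gt_eqF.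
have DE : D = P *m (M *m adjmx P).
  by rewrite -BB adjmxM adjmxK -mulmxA (mulmxA (adjmx X)).
have Ddiag : D = diag_mx (\row_i (singval X i ^+ 2)%:C%C) by [].
clearbody M D.
have DD : D *m D = (c ^+ 2)%:C%C *: D.
  rewrite {1 2}DE -(mulmxA P) -(mulmxA M) (mulmxA (adjmx P)) PP' mul1mx.
  by rewrite (mulmxA M) MM -scalemxAl -scalemxAr -DE.
have trD : \sum_i singval X i ^+ 2 = c ^+ 2 * k%:R.
  apply: complexI; rewrite -trM rmorph_sum -[M]mulmx1 -PP' mulmxA mxtrace_mulC -DE Ddiag.
  by apply: eq_bigr => i _; rewrite !mxE eqxx mulr1n.
have s0c i : singval X i = 0 \/ singval X i = c.
  have := congr1 (fun M : 'M[R[i]]_d => M i i) DD.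
  rewrite Ddiag mulmx_diag !mxE eqxx !mulr1n -!rmorphM/= => /complexI/eqP.
  rewrite -subr_eq0 -mulrBl mulf_eq0 => /orP[|]; last first.
    by rewrite sqrf_eq0 => /eqP; left.
  rewrite subr_eq0 eqrXn2 ?singval_ge0// => [/eqP|]; [by right|exact: ltW].
have d0 : (0 < d)%N.
  case: (posnP d) => // d0; move: trD; rewrite big1 => [/eqP|i _]; last first.
    by have := ltn_ord i; rewrite {2}d0.
  by rewrite eq_sym mulf_eq0 (negbTE c2)/= pnatr_eq0 gtn_eqF.
case: p p1 => [p|_|//].
  rewrite lee_fin => p1; have p0 : 0 < p by rewrite (lt_le_trans ltr01).
  rewrite schatten_norm_fin rinv_fin//.
  have -> : \sum_i singval X i `^ p = c `^ p * k%:R.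
    transitivity (c `^ p / c ^+ 2 * \sum_i singval X i ^+ 2); last first.
      by rewrite trD mulrA divfK.
    rewrite mulr_sumr; apply: eq_bigr => i _; case: (s0c i) => ->.
      by rewrite powR0 ?gt_eqF// expr0n mulr0.
    by rewrite divfK.
  rewrite powRM ?powR_ge0// -powRrM divff ?gt_eqF// powRr1//; exact: ltW.
have -> : rinv (+oo%E : \bar R) = 0 by rewrite /rinv invey.
rewrite powRr0 mulr1.
have [i iE] := schatten_norm_infty_attained X d0.
case: (s0c i) => si; last by rewrite iE.
exfalso; move/eqP: trD; rewrite big1 => [|j _].
  by rewrite eq_sym mulf_eq0 (negbTE c2)/= pnatr_eq0 gtn_eqF.
have := schatten_norm_infty_ge X j; rewrite iE si => sj.
by apply/eqP; rewrite sqrf_eq0 eq_le sj singval_ge0.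
Qed.

Definition monomial_mx w s : 'M[R[i]]_d := \matrix_(i, j) ((w i)%:C%C *+ (j == s i)).

(* The weights are 0 or +-c, and exactly k of them are nonzero. *)
Definition flat w (c : R) (k : nat) : Prop := exists A : pred 'I_d,
  [/\ 0 < c, (0 < k)%N, #|A| = k & forall i, w i ^+ 2 = c ^+ 2 * (A i)%:R].

Lemma schatten_norm_monomial (p : \bar R) w s c k : (1 <= p)%E ->
  involutive s -> flat w c k ->
  schatten_norm p (monomial_mx w s) = c * k%:R `^ rinv p.
Proof.
move=> p1 sK [A [c0 k0 Ak wA]].
have M : adjmx (monomial_mx w s) *m monomial_mx w s =
    diag_mx (\row_i (c ^+ 2 * (A (s i))%:R)%:C%C).
  apply/matrixP => i j; rewrite !mxE (bigD1 (s i))//= big1 ?addr0 => [|k' k's].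
    rewrite !mxE sK eqxx mulr1n eq_sym -wA; case: (i == j); rewrite ?mulr0//.
    by rewrite !mulr1n mulrC -cabs_sqr cabs_real real_normK ?num_real.
  rewrite !mxE; case: eqP => [ik|]; first by rewrite ik sK eqxx in k's.
  by rewrite mulr0n rmorph0 mul0r.
apply: schatten_norm_flat => //; rewrite M.
  rewrite mulmx_diag; apply/matrixP => i j; rewrite !mxE.
  case: (i == j); rewrite ?mulr0n ?mulr0// !mulr1n -!rmorphM/=; congr (_%:C%C).
  by case: (A (s i)); rewrite ?mulr0 ?mulr1.
rewrite mxtrace_diag; under eq_bigr do rewrite mxE.
rewrite -rmorph_sum -mulr_sumr; congr ((_ * _)%:C%C).
rewrite (reindex_inj (inv_inj sK))/=; under eq_bigr do rewrite sK.
by rewrite -natr_sum -Ak -sum1_card [in RHS]big_mkcond.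
Qed.

Lemma commutator_monomial w s w' s' : (forall i, s' (s i) = s (s' i)) ->
  monomial_mx w s *m monomial_mx w' s' - monomial_mx w' s' *m monomial_mx w s =
  monomial_mx (fun i => w i * w' (s i) - w' i * w (s' i)) (s' \o s).
Proof.
move=> ss; have mul v t v' t' : monomial_mx v t *m monomial_mx v' t' =
    monomial_mx (fun i => v i * v' (t i)) (t' \o t).
  apply/matrixP => i j; rewrite !mxE (bigD1 (t i))//= big1 ?addr0 => [|k kt].
    by rewrite !mxE eqxx mulr1n mulrnAr -rmorphM.
  by rewrite !mxE (negbTE kt) mul0r.
rewrite !mul; apply/matrixP => i j; rewrite !mxE /= ss -mulrnBl.
by rewrite -rmorphB.
Qed.

Lemma monomial_lower_bound (p q r : \bar R) (C : R) w s w' s' c1 k1 c2 k2 c3 k3 :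
  (1 <= p)%E -> (1 <= q)%E -> (1 <= r)%E ->
  involutive s -> involutive s' -> (forall i, s' (s i) = s (s' i)) ->
  flat w c1 k1 -> flat w' c2 k2 ->
  flat (fun i => w i * w' (s i) - w' i * w (s' i)) c3 k3 ->
  commutator_bounds d p q r C ->
  c3 * k3%:R `^ rinv p <= C * (c1 * k1%:R `^ rinv q) * (c2 * k2%:R `^ rinv r).
Proof.
move=> p1 q1 r1 sK s'K ss fw fw' fww' /(_ (monomial_mx w s) (monomial_mx w' s')).
rewrite commutator_monomial// !(schatten_norm_monomial _ _ fw, schatten_norm_monomial _ _ fw')//.
rewrite (schatten_norm_monomial p1 _ fww')// => i /=.
by rewrite ss s'K sK.
Qed.

(** Exchanges 2m and 2m + 1 below n; for even n <= d the default of [insubd] is never reached. *)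
Definition pair_swap (n : nat) (i : 'I_d) : 'I_d :=
  if (i < n)%N then insubd i (if odd i then i.-1 else i.+1) else i.

Lemma pair_swapE n i : ~~ odd n -> (n <= d)%N ->
  pair_swap n i = (if (i < n)%N then if odd i then i.-1 else i.+1 else i) :> nat.
Proof.
move=> nodd nd; rewrite /pair_swap; case: ifP => // ilt; rewrite val_insubd.
suff -> : ((if odd i then i.-1 else i.+1) < d)%N by [].
case: ifP => iodd; first by rewrite (leq_ltn_trans (leq_pred _)).
apply: leq_trans nd; rewrite ltn_neqAle ilt andbT.
by apply/eqP => E; move: nodd; rewrite -E/= iodd.
Qed.

Lemma pair_swapK n : ~~ odd n -> (n <= d)%N -> involutive (pair_swap n).
Proof.
move=> nodd nd i; apply: val_inj; rewrite /= !pair_swapE//.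
case: (ltnP i n) => ilt; last by rewrite ltnNge ilt.
have [iodd|ieven] := boolP (odd i).
  have odd_pred : odd i.-1 = false by rewrite -subn1 oddB ?odd_gt0// iodd.
  by rewrite (leq_ltn_trans (leq_pred _) ilt) odd_pred prednK ?odd_gt0.
rewrite /= (negbTE ieven)/= ltn_neqAle ilt andbT ifT//.
by apply/eqP => E; move: nodd; rewrite -E/= (negbTE ieven).
Qed.

Lemma flat_nat (P : pred nat) w c k : 0 < c -> (0 < k)%N ->
  (\sum_(0 <= i < d | P i) 1)%N = k ->
  (forall i : 'I_d, w i ^+ 2 = c ^+ 2 * (P i)%:R) -> flat w c k.
Proof.
move=> c0 k0 Pk wP; exists (fun i : 'I_d => P i); split=> //.
by rewrite -sum1_card -Pk big_mkord; apply: eq_bigl => i; rewrite unfold_in.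
Qed.

Lemma card_ltn n : (n <= d)%N -> (\sum_(0 <= i < d | (i < n)%N) 1)%N = n.
Proof.
by move=> nd; rewrite -(big_nat_widen 0 n d predT)// sum_nat_const_nat subn0 muln1.
Qed.

Lemma card_pred1 m : (m < d)%N -> (\sum_(0 <= i < d | i == m) 1)%N = 1%N.
Proof. by move=> md; rewrite big_nat1_eq md. Qed.

End LowerBounds.

(** * Explicit pairs of matrices for the lower bounds *)

Section Examples.
Variables (R : realType) (d : nat) (p q r : \bar R) (C : R).
Hypotheses (d2 : (2 <= d)%N) (p1 : (1 <= p)%E) (q1 : (1 <= q)%E) (r1 : (1 <= r)%E).
Hypothesis bC : commutator_bounds d p q r C.

Let d0 : (0 < d)%N. Proof. exact: ltnW. Qed.
Let swap2 : 'I_d -> 'I_d := @pair_swap d 2.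
Let swap2K : involutive swap2. Proof. exact: pair_swapK. Qed.
Let swap2E i : swap2 i = (if (i < 2)%N then if odd i then i.-1 else i.+1 else i) :> nat.
Proof. exact: pair_swapE. Qed.

Let unit_weight m (i : 'I_d) : R := (i == m :> nat)%:R.

Let flat_unit m : (m < d)%N -> flat (unit_weight m) 1 1.
Proof.
move=> md; apply: (@flat_nat R d (pred1 m)) => //; first exact: card_pred1.
by move=> i; rewrite /unit_weight/= expr1n mul1r; case: eqP => _; rewrite ?expr1n ?expr0n.
Qed.

Let diff_weight (i : 'I_d) : R := (i == 0%N :> nat)%:R - (i == 1%N :> nat)%:R.

Let flat_diff : flat diff_weight 1 2.
Proof.
apply: (@flat_nat R d (fun m => (m < 2)%N)) => //; first exact: card_ltn.
by move=> i; rewrite /diff_weight; case: (nat_of_ord i) => [|[|m]] /=; ring.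
Qed.

(** X = E_01 and Y = E_10, with commutator E_00 - E_11. *)
Lemma commutator_lower_p : 2 `^ rinv p <= C.
Proof.
have := @monomial_lower_bound R d p q r C _ swap2 _ swap2 _ _ _ _ 1 2
  p1 q1 r1 swap2K swap2K (fun=> erefl) (flat_unit d0) (flat_unit d2) _ bC.
rewrite !mul1r !powR1 !mulr1; apply.
apply: (@flat_nat R d (fun m => (m < 2)%N)) => //; first exact: card_ltn.
move=> i; rewrite /unit_weight !swap2E; case: (nat_of_ord i) => [|[|m]] /=; ring.
Qed.

(** X = E_00 - E_11 and Y = E_01, with commutator 2 E_01; exchanging X and Y serves for r. *)
Lemma commutator_lower_q : 2 `^ (1 - rinv q) <= C.
Proof.
have := @monomial_lower_bound R d p q r C _ id _ swap2 _ _ _ _ 2 1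
  p1 q1 r1 (fun=> erefl) swap2K (fun=> erefl) flat_diff (flat_unit d0) _ bC.
rewrite !mul1r !powR1 !mulr1 => H.
rewrite powRB ?pnatr_eq0 ?implybT// powRr1// ler_pdivrMr ?powR_gt0//; apply: H.
apply: (@flat_nat R d (pred1 0%N)) => //; first exact: card_pred1.
move=> i; rewrite /unit_weight /diff_weight !swap2E; case: (nat_of_ord i) => [|[|m]] /=; ring.
Qed.

Lemma commutator_lower_r : 2 `^ (1 - rinv r) <= C.
Proof.
have := @monomial_lower_bound R d p q r C _ swap2 _ id _ _ _ _ 2 1
  p1 q1 r1 swap2K (fun=> erefl) (fun=> erefl) (flat_unit d0) flat_diff _ bC.
rewrite !mul1r !powR1 !mulr1 => H.
rewrite powRB ?pnatr_eq0 ?implybT// powRr1// ler_pdivrMr ?powR_gt0//; apply: H.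
apply: (@flat_nat R d (pred1 0%N)) => //; first exact: card_pred1.
move=> i; rewrite /unit_weight /diff_weight !swap2E; case: (nat_of_ord i) => [|[|m]] /=; ring.
Qed.

(** On the first n coordinates X is the diagonal of alternating signs and Y exchanges neighbours in
    pairs. They anticommute, so [X, Y] = 2 X Y, and all three matrices have n equal nonzero singular
    values. Case (i) takes n = 2, case (ii) n = d. *)
Lemma commutator_lower_even n : ~~ odd n -> (0 < n)%N -> (n <= d)%N ->
  2 * n%:R `^ (rinv p - rinv q - rinv r) <= C.
Proof.
move=> nodd n0 nd.
pose w (i : 'I_d) : R := (-1) ^+ (nat_of_ord i) * (i < n)%N%:R.
pose w' (i : 'I_d) : R := (i < n)%N%:R.
have w2 m : (((-1) ^+ m : R) * (m < n)%N%:R) ^+ 2 = 1 ^+ 2 * (m < n)%N%:R.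
  by rewrite exprMn sqrr_sign expr1n; case: (m < n)%N; rewrite ?expr1n ?expr0n.
have fw : flat w 1 n.
  by apply: (@flat_nat R d (fun m => (m < n)%N)) => //; [exact: card_ltn|move=> i; exact: w2].
have fw' : flat w' 1 n.
  apply: (@flat_nat R d (fun m => (m < n)%N)) => //; first exact: card_ltn.
  by move=> i; rewrite /w'; case: (i < n)%N; rewrite !expr1n ?expr0n ?mulr1 ?mulr0.
have := @monomial_lower_bound R d p q r C w id w' (@pair_swap d n) 1 n 1 n 2 n
  p1 q1 r1 (fun=> erefl) (pair_swapK nodd nd) (fun=> erefl) fw fw' _ bC.
rewrite !mul1r => H; have nR : n%:R != 0 :> R by rewrite pnatr_eq0 -lt0n.
rewrite !powRB ?nR ?implybT// !mulrA ler_pdivrMr ?powR_gt0 ?ltr0n//.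
rewrite ler_pdivrMr ?powR_gt0 ?ltr0n// [leRHS]mulrAC; apply: H.
apply: (@flat_nat R d (fun m => (m < n)%N)) => //; first exact: card_ltn.
move=> i; rewrite /w /w' pair_swapE//; case: (ltnP i n) => ilt; last by rewrite /=; ring.
case: (boolP (odd i)) => iodd.
  rewrite (leq_ltn_trans (leq_pred _) ilt).
  have odd_pred : odd i.-1 = false by rewrite -subn1 oddB ?odd_gt0// iodd.
  by rewrite -signr_odd iodd -[(-1) ^+ i.-1]signr_odd odd_pred expr0 expr1 /=; ring.
have -> : (i.+1 < n)%N.
  by rewrite ltn_neqAle ilt andbT; apply/eqP => E; move: nodd; rewrite -E/= (negbTE iodd).
by rewrite [(-1) ^+ i.+1]exprS -signr_odd (negbTE iodd) expr0 /=; ring.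
Qed.

End Examples.

(** * The commutator constant *)

Section Exponents.
Variable R : realType.
Implicit Types p q r : \bar R.
Local Open Scope ereal_scope.

Lemma inve_rinv p : 1 <= p -> p^-1 = (rinv p)%:E.
Proof.
case: p => [p||//]; last by rewrite /rinv invey.
by rewrite lee_fin => p1; rewrite rinv_fin ?(lt_le_trans ltr01)// inver gt_eqF ?(lt_le_trans ltr01).
Qed.

Lemma rinv_ge0 p : 1 <= p -> (0 <= rinv p)%R.
Proof. by move=> p1; rewrite -lee_fin -inve_rinv// inve_ge0 (le_trans lee01). Qed.

Lemma le_rinv p q : 1 <= p -> 1 <= q -> (p <= q) = (rinv q <= rinv p)%R.
Proof.
move=> p1 q1; rewrite -lee_fin -!inve_rinv// lee_pV2//.
  by rewrite inE/= (le_trans lee01).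
by rewrite inE/= (le_trans lee01).
Qed.

Lemma rinv1 : rinv (1%:E : \bar R) = 1%R.
Proof. by rewrite rinv_fin// invr1. Qed.

Lemma rinv2 : rinv (2%:E : \bar R) = 2^-1%R.
Proof. by rewrite rinv_fin. Qed.

Lemma rinv_le1 p : 1 <= p -> (rinv p <= 1)%R.
Proof. by move=> p1; rewrite -rinv1 -le_rinv. Qed.

Lemma rinv_hoelder_conjugate p : 1 <= p ->
  rinv (hoelder_conjugate p) = (1 - rinv p)%R.
Proof.
move=> p1; have := @hoelder_conjugate_eq1 R p.
rewrite !inve_rinv ?hoelder_conj_ge1// gt_eqF ?(lt_le_trans lte01)//.
rewrite (lt_le_trans (ltNyr 1) p1) => /(_ isT isT).
by rewrite -EFinD => -[<-]; rewrite addrAC subrr add0r.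
Qed.

End Exponents.

Lemma powR_max (R : realType) (x y z : R) : 1 <= x ->
  x `^ Num.max y z = Num.max (x `^ y) (x `^ z).
Proof.
move=> x1; case: (leP y z) => h.
  by rewrite (max_idPr _)// ler_powR.
by rewrite (max_idPl _)// ler_powR// ltW.
Qed.

(** The infimum of the bounds is itself a bound: for positive norms divide by them, and if a norm
    vanishes the crude bound 2 d already forces the commutator to have norm 0. *)
Lemma commutator_constant_exists (R : realType) (d : nat) (p q r : \bar R) :
  (2 <= d)%N -> (1 <= p)%E -> (1 <= q)%E -> (1 <= r)%E ->
  exists C, is_commutator_constant d p q r C.
Proof.
move=> d2 p1 q1 r1; have d0 : (0 < d)%N by exact: ltnW.
have bounded : commutator_bounds d p q r (2 * d%:R).
  apply: comm_bound_commutator_bounds => //.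
  apply: comm_bound_mono (@comm_bound000 R d); rewrite ?rinv_ge0//.
  by rewrite subr_ge0 rinv_le1.
have lb : lbound (commutator_bounds d p q r) (2 `^ rinv p).
  by move=> C; exact: commutator_lower_p.
exists (inf (commutator_bounds d p q r)); split; last first.
  by move=> C bC; apply: ge_inf => //; exists (2 `^ rinv p).
move=> X Y; have NX := schatten_norm_ge0 q X d0; have NY := schatten_norm_ge0 r Y d0.
have := schatten_norm_ge0 p (X *m Y - Y *m X) d0.
move: NX NY; rewrite le_eqVlt => /predU1P[X0|NX].
  by move=> _ _; have := bounded X Y; rewrite -X0 !(mulr0, mul0r).
rewrite le_eqVlt => /predU1P[Y0|NY].
  by move=> _; have := bounded X Y; rewrite -Y0 !mulr0.
move=> _; rewrite -mulrA -ler_pdivrMr ?mulr_gt0//; apply: lb_le_inf.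
  by exists (2 * d%:R).
by move=> C bC; rewrite ler_pdivrMr ?mulr_gt0// mulrA; exact: bC.
Qed.

Theorem theorem3 (R : realType) (d : nat) (p q r : \bar R)
    (hd : (2 <= d)%N)
    (hp : (1 <= p)%E) (hq : (1 <= q)%E) (hr : (1 <= r)%E) :
  exists2 Cpqr : R, is_commutator_constant d p q r Cpqr &
    (* (i) *)
    [/\ (p^-1 <= q^-1 + r^-1)%E ->
        ~ [/\ (2%:E < p)%E, (q < 2%:E)%E & (r < 2%:E)%E] ->
        Cpqr = Num.max
          (Num.max (2 `^ rinv p) (2 `^ (1 - rinv q)))
          (Num.max (2 `^ (1 - rinv r)) (2 `^ (1 + rinv p - rinv q - rinv r))),
      [/\ [/\ (q <= hoelder_conjugate p)%E, (r <= hoelder_conjugate p)%E,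
              (r <= hoelder_conjugate q)%E & (p <= 2%:E)%E] ->
          Cpqr = 2 `^ rinv p,
          [/\ (hoelder_conjugate p <= r)%E, (q <= r)%E, (q <= p)%E
            & (2%:E <= r)%E] ->
          Cpqr = 2 `^ (1 - rinv r),
          [/\ (hoelder_conjugate p <= q)%E, (r <= q)%E, (r <= p)%E
            & (2%:E <= q)%E] ->
          Cpqr = 2 `^ (1 - rinv q)
        & [/\ (p^-1 <= q^-1 + r^-1)%E, (p <= q)%E, (p <= r)%E
            & (hoelder_conjugate q <= r)%E] ->
          Cpqr = 2 `^ (1 + rinv p - rinv q - rinv r)],
    (* (ii) *)
        (q^-1 + r^-1 <= p^-1)%E -> ~~ odd d ->
        Cpqr = 2 * d%:R `^ (rinv p - rinv q - rinv r)
      & (q^-1 + r^-1 <= p^-1)%E -> odd d ->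
        Cpqr <= 2 * d%:R `^ (rinv p - rinv q - rinv r)].
Proof.
have [C [bC lbC]] := commutator_constant_exists hd hp hq hr.
exists C; first by [].
have d0 : (0 < d)%N by exact: ltnW.
have hpc := hoelder_conj_ge1 hp; have hqc := hoelder_conj_ge1 hq.
have h2 : (1 <= 2%:E :> \bar R)%E by rewrite lee_fin ler1n.
(* All conditions become linear inequalities in 1/p, 1/q, 1/r, the conjugate index contributing 1 -
   1/p. *)
rewrite (ltNge 2%:E) (ltNge q) (ltNge r) (le_rinv hp h2) (le_rinv h2 hq) (le_rinv h2 hr).
rewrite (le_rinv hq hpc) (le_rinv hr hpc) (le_rinv hr hqc) (le_rinv hpc hr) (le_rinv hpc hq).
rewrite (le_rinv hqc hr) (le_rinv hp hq) (le_rinv hp hr) (le_rinv hq hp) (le_rinv hq hr).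
rewrite (le_rinv hr hp) (le_rinv hr hq) !rinv_hoelder_conjugate// rinv2.
rewrite !inve_rinv// -EFinD !lee_fin.
have a0 := rinv_ge0 hp; have b0 := rinv_ge0 hq; have c0 := rinv_ge0 hr.
have a1 := rinv_le1 hp; have b1 := rinv_le1 hq; have c1 := rinv_le1 hr.
have lowp := commutator_lower_p hd hp hq hr bC.
have lowq := commutator_lower_q hd hp hq hr bC.
have lowr := commutator_lower_r hd hp hq hr bC.
have loweven n := @commutator_lower_even R d p q r C hp hq hr bC n.
have upper M : comm_bound d (1 - rinv p) (rinv q) (rinv r) M -> C <= M.
  by move=> cb; apply: lbC; exact: comm_bound_commutator_bounds cb.
move: (rinv p) (rinv q) (rinv r) => a b c in a0 b0 c0 a1 b1 c1 lowp lowq lowr loweven upper *.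
clear hp hq hr hpc hqc h2 bC lbC.
have lows : 2 `^ (1 + a - b - c) <= C.
  have -> : 1 + a - b - c = 1 + (a - b - c) by ring.
  by rewrite powRD ?pnatr_eq0 ?implybT// powRr1// (loweven 2).
have value x : a <= b + c -> ~ [/\ a < 2^-1, 2^-1 < b & 2^-1 < c] ->
    a <= x -> 1 - b <= x -> 1 - c <= x -> 1 + a - b - c <= x ->
    2 `^ x <= C -> C = 2 `^ x.
  move=> abc nabc ax bx cx sx Cx; apply/eqP; rewrite eq_le Cx andbT.
  apply: upper; apply: comm_bound_region => //; try lra.
  by move=> [? ? ?]; apply: nabc; split=> //; lra.
split.
- move=> abc nabc; rewrite -!powR_max ?ler1n//.
  set x := Num.max (Num.max a _) _.
  have := lexx x; rewrite {1}/x !ge_max => /andP[/andP[ax bx] /andP[cx sx]].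
  apply: value => //.
    by move=> [? ? ?]; apply: nabc; rewrite -!ltNge.
  by rewrite /x !powR_max ?ler1n// !ge_max lowp lowq lowr lows.
(* In each segment the named exponent dominates the other three and the excluded case is
   contradictory, both by linear arithmetic. *)
- split=> -[h1 h2' h3 h4]; apply: value => //; try lra; by move=> [? ? ?]; lra.
- move=> abc dev; apply/eqP; rewrite eq_le loweven// andbT; apply: upper.
  have := @comm_bound_Hoelder R d (1 - a) b c d0.
  have -> : 1 - (1 - a + b + c) = a - b - c by ring.
  by apply=> //; lra.
- move=> abc _; apply: upper.
  have := @comm_bound_Hoelder R d (1 - a) b c d0.
  have -> : 1 - (1 - a + b + c) = a - b - c by ring.
  by apply=> //; lra.
Qed.
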